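(* Let $R$ be a commutative Noetherian semiperfect ring, let $C$ be a semidualizing $R$-module, let $M$ be a reduced $\mathrm{G}_C$-perfect $R$-module of $\mathrm{G}_C$-dimension $n$, and let $k\ge 0$ be an integer. Then $M$ is $C$-$k$-torsionless if and only if $$\mathrm{grade}_R(\mathrm{Ext}_R^n(M,C))\ge n+k.$$
   Context: A commutative Noetherian ring is semiperfect iff it is a finite direct product of local rings. ''Finite'' module means finitely generated. A finite $R$-module $C$ is semidualizing if the homothety map $R\to\mathrm{Hom}_R(C,C)$ is an isomorphism and $\mathrm{Ext}^i_R(C,C)=0$ for all $i>0$. Write $(-)^C=\mathrm{Hom}_R(-,C)$. A finite module $X$ is totally $C$-reflexive if the biduality map $X\to X^{CC}$ is an isomorphism and $\mathrm{Ext}^i_R(X,C)=\mathrm{Ext}^i_R(X^C,C)=0$ for all $i>0$. For a finite module $M$, $\mathrm{G}_C\text{-}\dim_R(M)$ is the smallest $n\ge 0$ such that there is an exact sequence $0\to X_n\to\cdots\to X_0\to M\to 0$ with all $X_i$ totally $C$-reflexive, and $\infty$ if no such $n$ exists. $\mathrm{grade}_R(M)=\inf\{i\ge 0\mid \mathrm{Ext}^i_R(M,R)\ne 0\}$ and $\mathrm{r.grade}_R(M,C)=\inf\{i>0\mid \mathrm{Ext}^i_R(M,C)\ne 0\}$ (with $\inf\emptyset=\infty$). A finite module $M$ with finite $\mathrm{G}_C$-dimension is reduced $\mathrm{G}_C$-perfect if $\mathrm{r.grade}_R(M,C)=\mathrm{G}_C\text{-}\dim_R(M)$ (so its $\mathrm{G}_C$-dimension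 is automatically positive). If $P_1\xrightarrow{f}P_0\to M\to 0$ is a presentation by finite projective modules, $\mathrm{Tr}_C(M)=\mathrm{Coker}(f^C\colon P_0^C\to P_1^C)$; $\mathrm{Ext}^i_R(\mathrm{Tr}_C(M),C)$ for $i>0$ does not depend on the choice of presentation. A finite module $M$ is $C$-$k$-torsionless if either $k=0$, or $k\ge 1$ and $\mathrm{Ext}^i_R(\mathrm{Tr}_C(M),C)=0$ for all $1\le i\le k$. *)

(* Defs.v *)
From HB Require Import structures.
From mathcomp Require Import all_boot all_order all_algebra ring_quotient.
From mathcomp Require Import boolp classical_sets.
From mathcomp Require Import freeg.

Set Implicit Arguments.
Unset Strict Implicit.
Unset Printing Implicit Defensive.

Import GRing.Theory.
Local Open Scope ring_scope.
Local Open Scope quotient_scope.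
Local Open Scope classical_set_scope.

(* None stands for infinity. *)
Definition enat := option nat.

Definition enat_le (m : nat) (x : enat) : Prop :=
  if x is Some p then (m <= p)%N else True.

Definition einf (P : set nat) : enat :=
  if pselect (exists n, `[< P n >]) is left exP then Some (ex_minn exP) else None.

Lemma einf_SomeP (P : set nat) n :
  einf P = Some n <-> P n /\ (forall m, P m -> (n <= m)%N).
Proof.
rewrite /einf; case: pselect => [exP|nexP]; last first.
  by split=> // -[Pn _]; case: nexP; exists n; apply/asboolP.
case: ex_minnP => m /asboolP Pm minm; split=> [[<-]|[Pn minn]].
  by split=> // p Pp; apply/minm/asboolP.
by congr Some; apply/eqP; rewrite eqn_leq minn // minm //; apply/asboolP.
Qed.

Lemma einf_NoneP (P : set nat) : einf P = None <-> forall n, ~ P n.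
Proof.
rewrite /einf; case: pselect => [exP|nexP]; split=> //.
  by move=> nP; have [n Pn] := exP; case: (nP n); apply/asboolP.
by move=> _ n Pn; apply: nexP; exists n; apply/asboolP.
Qed.

Section Rings.
Variable R : comNzRingType.

Definition is_ideal (I : set R) : Prop :=
  [/\ I 0, forall x y, I x -> I y -> I (x + y) & forall a x, I x -> I (a * x)].

Definition noetherian : Prop :=
  forall I : set R, is_ideal I ->
    exists s : seq R, forall x, I x <-> exists c : nat -> R,
      x = \sum_(i < size s) c i * s`_i.

Definition is_maximal_ideal (m : set R) : Prop :=
  [/\ is_ideal m, ~ m 1 &
      forall J, is_ideal J -> m `<=` J -> ~ J 1 -> J = m].

Definition local_ring : Prop := exists! m : set R, is_maximal_ideal m.

End Rings.

(* The last clause says that x |-> (f i x)_i is a bijection, hence a ring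
   isomorphism, from R onto the product of the S i. *)
Definition semiperfect (R : comNzRingType) : Prop :=
  exists (m : nat) (S : 'I_m -> comNzRingType) (f : forall i, {rmorphism R -> S i}),
    (forall i, local_ring (S i)) /\
    (forall s : forall i, S i, exists! x : R, forall i, f i x = s i).

Section Modules.
Variable R : comNzRingType.
Implicit Types U V W M N : lmodType R.

Definition finite_module M : Prop :=
  exists s : seq M, forall x, exists c : nat -> R,
    x = \sum_(i < size s) c i *: s`_i.

Definition zero_module M : Prop := forall x : M, x = 0.

Definition surj U V (f : {linear U -> V}) : Prop := forall v, exists u, f u = v.

Definition projective_module (P : lmodType R) : Prop :=
  forall U V (p : {linear U -> V}) (g : {linear P -> V}),
    surj p -> exists h : {linear P -> U}, forall x, p (h x) = g x.

Definition exact_at U V W (f : {linear U -> V}) (g : {linear V -> W}) : Prop :=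
  forall v, g v = 0 <-> exists u, f u = v.

Definition ker_pred U V (f : {linear U -> V}) : U -> bool := fun x => f x == 0.

Fact ker_pred_closed U V (f : {linear U -> V}) :
  subsemimod_closed (ker_pred f).
Proof.
split; first split=> [|x y].
- by rewrite unfold_in /ker_pred linear0.
- by rewrite !unfold_in /ker_pred linearD => /eqP-> /eqP->; rewrite addr0.
- by move=> a x; rewrite !unfold_in /ker_pred linearZ_LR => /eqP->; rewrite scaler0.
Qed.

HB.instance Definition _ U V (f : {linear U -> V}) :=
  GRing.isSubmodClosed.Build R U (ker_pred f) (ker_pred_closed f).

Definition Ker U V (f : {linear U -> V}) : Type := {x : U | ker_pred f x}.

HB.instance Definition _ U V (f : {linear U -> V}) :=
  SubChoice.on (Ker f).
HB.instance Definition _ U V (f : {linear U -> V}) :=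
  [SubChoice_isSubLmodule of Ker f by <:].

Definition im_pred U V (f : {linear U -> V}) : V -> bool :=
  fun y => `[< exists x, f x = y >].

Fact im_pred_closed U V (f : {linear U -> V}) :
  subsemimod_closed (im_pred f).
Proof.
split; first split=> [|x y].
- by apply/asboolP; exists 0; rewrite linear0.
- move=> /asboolP[u <-] /asboolP[v <-].
  by apply/asboolP; exists (u + v); rewrite linearD.
- move=> a x /asboolP[u <-].
  by apply/asboolP; exists (a *: u); rewrite linearZ_LR.
Qed.

HB.instance Definition _ U V (f : {linear U -> V}) :=
  GRing.isSubmodClosed.Build R V (im_pred f) (im_pred_closed f).

Definition subm_zmod V (S : submodClosed V) : zmodClosed V :=
  HB.pack_for (zmodClosed V) (GRing.SubmodClosed.sort S)
    (GRing.isZmodClosed.Build V (GRing.SubmodClosed.sort S) (GRing.subsemimod_closedB (GRing.subsemimodClosedP S))).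

Definition lquot V (S : submodClosed V) : Type := Quotient.quot (subm_zmod S).

Section LQuot.
Variables (V : lmodType R) (S : submodClosed V).

HB.instance Definition _ := GRing.Zmodule.copy (lquot S) (Quotient.quot (subm_zmod S)).

Definition lquot_pi (x : V) : lquot S := \pi_(Quotient.quot (subm_zmod S)) x.
Definition lquot_scale (a : R) (x : lquot S) : lquot S  :=
  lquot_pi (a *: (repr (x : Quotient.quot (subm_zmod S)) : V)).

Lemma lquot_piP x y : lquot_pi x = lquot_pi y <-> x - y \in S.
Proof.
by split=> [|h]; [move/eqP; rewrite -Quotient.idealrBE
                 |apply/eqP; rewrite -Quotient.idealrBE].
Qed.

Lemma lquot_pi_surj (x : lquot S) : exists v, lquot_pi v = x.
Proof. by exists (repr (x : Quotient.quot (subm_zmod S))); rewrite /lquot_pi reprK. Qed.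

Lemma lquot_piD : {morph lquot_pi : x y / x + y}.
Proof. by move=> x y; rewrite /lquot_pi (@raddfD _ _ (\pi_(Quotient.quot (subm_zmod S)))). Qed.

Lemma lquot_piZ a x : lquot_scale a (lquot_pi x) = lquot_pi (a *: x).
Proof.
apply/lquot_piP; rewrite -scalerBr rpredZ //.
by apply/lquot_piP; rewrite /lquot_pi reprK.
Qed.

Fact lquot_scaleA a b x : lquot_scale a (lquot_scale b x) = lquot_scale (a * b) x.
Proof. by have [v <-] := lquot_pi_surj x; rewrite !lquot_piZ scalerA. Qed.
Fact lquot_scale1 : left_id 1 lquot_scale.
Proof. by move=> x; have [v <-] := lquot_pi_surj x; rewrite !lquot_piZ scale1r. Qed.
Fact lquot_scaleDr : right_distributive lquot_scale +%R.
Proof.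
move=> a x y; have [v <-] := lquot_pi_surj x; have [w <-] := lquot_pi_surj y.
by rewrite -lquot_piD !lquot_piZ scalerDr lquot_piD.
Qed.
Fact lquot_scaleDl x : {morph lquot_scale^~ x : a b / a + b}.
Proof.
move=> a b; have [v <-] := lquot_pi_surj x.
by rewrite !lquot_piZ scalerDl lquot_piD.
Qed.

HB.instance Definition _ := GRing.Zmodule_isLmodule.Build R (lquot S)
  lquot_scaleA lquot_scale1 lquot_scaleDr lquot_scaleDl.

Fact lquot_pi_linear : linear lquot_pi.
Proof. by move=> a x y; rewrite lquot_piD -lquot_piZ. Qed.
HB.instance Definition _ :=
  GRing.isLinear.Build R V (lquot S) *:%R lquot_pi lquot_pi_linear.

End LQuot.

Definition Coker U V (f : {linear U -> V}) : lmodType R := lquot (GRing.SubmodClosed.clone R V (im_pred f) _).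

(* Homology of U -f-> V -g-> W at V; the submodule divided out is im f meet
   ker g, so that g \o f = 0 need not be supplied. *)
Section Homology.
Variables (U V W : lmodType R) (f : {linear U -> V}) (g : {linear V -> W}).

Definition bnd_pred : Ker g -> bool := fun z => im_pred f (val z).

Fact bnd_pred_closed : subsemimod_closed bnd_pred.
Proof.
have [[im0 imD] imZ] := im_pred_closed f.
split; first split=> [|x y].
- by rewrite unfold_in /bnd_pred linear0.
- by rewrite !unfold_in /bnd_pred linearD; apply: imD.
- by move=> a x; rewrite !unfold_in /bnd_pred linearZ_LR; apply: imZ.
Qed.

HB.instance Definition _ :=
  GRing.isSubmodClosed.Build R (Ker g) bnd_pred bnd_pred_closed.

Definition homology : lmodType R :=
  lquot (GRing.SubmodClosed.clone R (Ker g) bnd_pred _).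

End Homology.

Definition Hom M N : Type := {linear M -> N}.

Section HomModule.
Variables M N : lmodType R.
Implicit Types f g h : Hom M N.

HB.instance Definition _ := gen_eqMixin (Hom M N).
HB.instance Definition _ := gen_choiceMixin (Hom M N).

Lemma Hom_eqP f g : (forall x, f x = g x) <-> f = g.
Proof.
split=> [|-> //]; case: f => f [[af] [sf]]; case: g => g [[ag] [sg]] /= /funext fg.
by case: g / fg ag sg => ag sg; rewrite (Prop_irrelevance ag af) (Prop_irrelevance sg sf).
Qed.

Definition Hom_zero : Hom M N := \0.
Definition Hom_add f g : Hom M N := f \+ g.
Definition Hom_opp f : Hom M N := \- f.
Definition Hom_scale a f : Hom M N := a \*: f.

Fact Hom_addA : associative Hom_add.
Proof. by move=> f g h; apply/Hom_eqP => x /=; rewrite addrA. Qed.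
Fact Hom_addC : commutative Hom_add.
Proof. by move=> f g; apply/Hom_eqP => x /=; rewrite addrC. Qed.
Fact Hom_add0 : left_id Hom_zero Hom_add.
Proof. by move=> f; apply/Hom_eqP => x /=; rewrite add0r. Qed.
Fact Hom_addN : left_inverse Hom_zero Hom_opp Hom_add.
Proof. by move=> f; apply/Hom_eqP => x /=; rewrite addNr. Qed.

HB.instance Definition _ :=
  GRing.isZmodule.Build (Hom M N) Hom_addA Hom_addC Hom_add0 Hom_addN.

Fact Hom_scaleA a b f : Hom_scale a (Hom_scale b f) = Hom_scale (a * b) f.
Proof. by apply/Hom_eqP => x /=; rewrite scalerA. Qed.
Fact Hom_scale1 : left_id 1 Hom_scale.
Proof. by move=> f; apply/Hom_eqP => x /=; rewrite scale1r. Qed.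
Fact Hom_scaleDr : right_distributive Hom_scale +%R.
Proof. by move=> a f g; apply/Hom_eqP => x /=; rewrite scalerDr. Qed.
Fact Hom_scaleDl f : {morph Hom_scale^~ f : a b / a + b}.
Proof. by move=> a b; apply/Hom_eqP => x /=; rewrite scalerDl. Qed.

HB.instance Definition _ := GRing.Zmodule_isLmodule.Build R (Hom M N)
  Hom_scaleA Hom_scale1 Hom_scaleDr Hom_scaleDl.

End HomModule.

(* dual C f is the transpose f^C = Hom_R(f, C). *)
Section Dual.
Variables (M N C : lmodType R) (f : {linear M -> N}).

Definition dual_fun (g : Hom N C) : Hom M C := (g : {linear N -> C}) \o f.

Fact dual_fun_linear : linear dual_fun.
Proof. by move=> a g h; apply/Hom_eqP. Qed.
HB.instance Definition _ :=
  GRing.isLinear.Build R (Hom N C) (Hom M C) *:%R dual_fun dual_fun_linear.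

Definition dual : {linear Hom N C -> Hom M C} := dual_fun.

End Dual.

Section Biduality.
Variables (C M : lmodType R).

Definition eval_fun (x : M) : Hom M C -> C := fun f => f x.

Fact eval_fun_linear x : linear (eval_fun x).
Proof. by []. Qed.
HB.instance Definition _ x :=
  GRing.isLinear.Build R (Hom M C) C *:%R (eval_fun x) (eval_fun_linear x).

Definition biduality (x : M) : Hom (Hom M C) C := eval_fun x.

End Biduality.

Definition homothety C (a : R) : Hom C C := ( *:%R a : C -> C).

(* Ext, computed from the standard free resolution of M: F_0 is free on the set
   M, and F_{i+1} is free on the set of elements of the kernel of d_i. *)

Section FreeLift.
Variables (K : choiceType) (N : lmodType R) (h : K -> N).

Definition freelift : {freeg K / R} -> N := fglift h.

Fact freelift_linear : linear freelift.
Proof.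
have addl : zmod_morphism freelift := lift_is_additive h.
pose L := GRing.isZmodMorphism.Build _ _ freelift addl.
pose F : {additive {freeg K / R} -> N} := HB.pack freelift L.
have FE D : freelift D = \sum_(x <- dom D) coeff x D *: h x.
  rewrite -{1}[D]freeg_sumE -[freelift _]/(F _) raddf_sum.
  by apply: eq_bigr => x _; apply: liftU.
have FZ a D : freelift (a *: D) = a *: freelift D.
  rewrite [a *: D]/(fgscale a D) /fgscale -[freelift (\sum_(_ <- _) _)]/(F _).
  rewrite raddf_sum FE scaler_sumr.
  by apply: eq_bigr => x _; rewrite scalerA; apply: liftU.
by move=> a x y; rewrite -FZ; apply: (raddfD F).
Qed.
HB.instance Definition _ :=
  GRing.isLinear.Build R {freeg K / R} N *:%R freelift freelift_linear.

End FreeLift.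

Record arrow := Arrow {
  src : lmodType R;
  tgt : lmodType R;
  arrow_map :> {linear src -> tgt}
}.

Definition free_cover (K : choiceType) M (h : K -> M) : arrow :=
  Arrow (freelift h : {linear {freeg K / R} -> M}).

(* The next arrow has target src a and image the kernel of a. *)
Definition res_next (a : arrow) : arrow :=
  free_cover (fun z : {x : src a | a x == 0} => val z).

Section StandardResolution.
Variable M : lmodType R.

Definition res_arrow (i : nat) : arrow := iter i res_next (free_cover (@id M)).

Definition res_mod (i : nat) : lmodType R := src (res_arrow i).
Definition res_aug : {linear res_mod 0 -> M} := arrow_map (res_arrow 0).
Definition res_d (i : nat) : {linear res_mod i.+1 -> res_mod i} :=
  arrow_map (res_arrow i.+1).

Lemma res_aug_surj : surj res_aug.
Proof.
move=> x; exists (Freeg [:: (1, x)]).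
by rewrite /res_aug /= /freelift liftU scale1r.
Qed.

Lemma res_next_exact (a : arrow) :
  exact_at (arrow_map (res_next a)) (arrow_map a).
Proof.
move=> v; split=> [/eqP av|[u <-]].
  exists (Freeg [:: (1, exist _ v av)]).
  by rewrite /= /freelift liftU scale1r.
rewrite /= -[u]freeg_sumE !linear_sum big1 // => z _.
by rewrite /= /freelift liftU linearZ /= (eqP (valP z)) scaler0.
Qed.

Lemma res_exact0 : exact_at (res_d 0) res_aug.
Proof. exact: (@res_next_exact (res_arrow 0)). Qed.

Lemma res_exactS i : exact_at (res_d i.+1) (res_d i).
Proof. exact: (@res_next_exact (res_arrow i.+1)). Qed.

Lemma res_mod_projective i : projective_module (res_mod i).
Proof.
have freeP (K : choiceType) : projective_module {freeg K / R}.
  move=> U V p g psurj.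
  have [h hP] := choice (fun k : K => psurj (g (Freeg [:: (1, k)]))).
  exists (freelift h) => x; rewrite -[x]freeg_sumE !linear_sum.
  apply: eq_bigr => k _; rewrite /= /freelift liftU linearZ /= hP -linearZ.
  congr (g _); apply/eqP/freeg_eqP => y.
  by rewrite coeffZ !coeffU mul1r.
by case: i => [|i]; apply: freeP.
Qed.

End StandardResolution.

Definition Ext (i : nat) M N : lmodType R :=
  if i is j.+1 then homology (dual N (res_d M j)) (dual N (res_d M j.+1))
  else Ker (dual N (res_d M 0)).

Definition grade M : enat := einf [set i | ~ zero_module (Ext i M R^o)].

Definition rgrade M C : enat :=
  einf [set i | (0 < i)%N /\ ~ zero_module (Ext i M C)].

Definition semidualizing C : Prop :=
  [/\ finite_module C, bijective (homothety C) &
      forall i, (0 < i)%N -> zero_module (Ext i C C)].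

Definition totally_reflexive C X : Prop :=
  [/\ finite_module X, bijective (@biduality C X),
      forall i, (0 < i)%N -> zero_module (Ext i X C) &
      forall i, (0 < i)%N -> zero_module (Ext i (Hom X C) C)].

(* An exact sequence 0 -> X_n -> ... -> X_0 -> M -> 0, extended by X_i = 0 for
   i > n. *)
Definition GC_resolution C M (n : nat) : Prop :=
  exists (X : nat -> lmodType R) (d : forall i, {linear X i.+1 -> X i})
         (e : {linear X 0 -> M}),
    [/\ surj e, exact_at (d 0) e, forall i, exact_at (d i.+1) (d i),
        forall i, (i <= n)%N -> totally_reflexive C (X i) &
        forall i, (n < i)%N -> zero_module (X i)].

Definition GCdim C M : enat := einf [set n | GC_resolution C M n].

Definition reduced_GC_perfect C M : Prop :=
  [/\ finite_module M, GCdim C M <> None & rgrade M C = GCdim C M].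

(* Tr_C(M) depends on the presentation; f is its map P1 -> P0. *)
Definition Tr (C P1 P0 : lmodType R) (f : {linear P1 -> P0}) : lmodType R := Coker (dual C f).

Definition presentation (M P1 P0 : lmodType R) (f : {linear P1 -> P0})
    (p : {linear P0 -> M}) :
    Prop :=
  [/\ finite_module P1 /\ projective_module P1,
      finite_module P0 /\ projective_module P0, surj p & exact_at f p].

(* The vanishing of Ext^i(Tr_C(M), C) for i > 0 does not depend on the chosen
   presentation, so asking for one presentation or for all is the same. *)
Definition torsionless C (k : nat) M : Prop :=
  finite_module M /\
  (k = 0%N \/
   (0 < k)%N /\
   exists (P1 P0 : lmodType R) (f : {linear P1 -> P0}) (p : {linear P0 -> M}),
     presentation f p /\
     forall i, (1 <= i <= k)%N -> zero_module (Ext i (Tr C f) C)).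

End Modules.

(* Main.v *)
Require Import Defs.
From HB Require Import structures.
From mathcomp Require Import all_boot all_algebra.
From mathcomp Require Import boolp freeg.
(* Imported again because [vector] shadows [Hom]. *)
Require Import Defs.

(**
Choose a resolution X of M of length n by totally C-reflexive modules. As the
X_i are acyclic for Hom(-, C), the complex Q^i = Hom(X_i, C) computes Ext(M, C);
so it is exact in degrees 1, ..., n - 1 and N = Ext^n(M, C) is the cokernel of
Q^(n-1) -> Q^n. The Q^i are again acyclic for Hom(-, C), with Hom(Q^i, C) = X_i,
so T = Coker(Q^0 -> Q^1) is an (n-1)-st "syzygy" of N: Ext^j(N, C) = 0 for j < n
and Ext^(n-1+i)(N, C) = Ext^i(T, C) for i > 0.

The vanishing of Ext^i(T, C) can be read off M alone: for i = 1, 2 it says that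
the biduality map of M is injective, resp. surjective, and for i > 2 it says
that Ext^(i-2)(M^C, C) = 0. The same holds for Tr_C(M), as finite projective
modules share the properties of the X_i that were used. Hence M is
C-k-torsionless iff Ext^j(N, C) = 0 for all j < n + k.

Finally R may be exchanged with C here. Applying Hom(-, C) to a free resolution F
of C gives a coresolution of R by products of copies of C, so that the vanishing
of Ext^j(N, C) for j < m implies that of Ext^j(N, R). Conversely, if
L = Ext^j(N, C) is the first nonzero one, then Hom(C, L) embeds into Ext^j(N, R),
and Hom(C, L) is nonzero because C is finite and faithful.
*)

(** * Linear maps and short exact sequences *)

Section Linear.
Set Implicit Arguments.
Unset Strict Implicit.
Unset Printing Implicit Defensive.
Import GRing.Theory.
Local Open Scope ring_scope.

Variable R : comNzRingType.
Implicit Types A B C D E F K M N P Q U V W : lmodType R.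

Lemma linear_mk U V (f : U -> V) : linear f ->
  exists h : {linear U -> V}, forall x, h x = f x.
Proof.
move=> lf.
by exists (HB.pack_for {linear U -> V} f (GRing.isLinear.Build R U V *:%R f lf)).
Qed.

Lemma factor_surj U V W (p : {linear U -> V}) (g : {linear U -> W}) :
  surj p -> (forall u, p u = 0 -> g u = 0) ->
  exists h : {linear V -> W}, forall u, h (p u) = g u.
Proof.
move=> psurj pg; have [s sK] := choice psurj.
have gE u u' : p u = p u' -> g u = g u'.
  move=> e; apply/eqP; rewrite -subr_eq0 -linearB; apply/eqP/pg.
  by rewrite linearB e subrr.
have [|h hE] := @linear_mk V W (g \o s).
  by move=> a x y /=; rewrite -linearP; apply: gE; rewrite linearP !sK.
by exists h => u; rewrite hE; apply: gE; rewrite sK.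
Qed.

Definition inj0 U V (f : {linear U -> V}) := forall x, f x = 0 -> x = 0.

Lemma inj0_eq U V (f : {linear U -> V}) x y : inj0 f -> f x = f y -> x = y.
Proof.
by move=> fi e; apply/eqP; rewrite -subr_eq0; apply/eqP/fi; rewrite linearB e subrr.
Qed.

Lemma factor_inj U V W (i : {linear V -> W}) (g : {linear U -> W}) :
  inj0 i -> (forall u, exists v, i v = g u) ->
  exists h : {linear U -> V}, forall u, i (h u) = g u.
Proof.
move=> iinj /choice[s sE].
have [|h hE] := @linear_mk U V s.
  by move=> a x y; apply: (inj0_eq iinj); rewrite linearP !sE linearP.
by exists h => u; rewrite hE sE.
Qed.

Definition copair U V W (f : {linear U -> W}) (g : {linear V -> W}) :
  {linear (U * V)%type -> W} := (f \o fst) \+ (g \o snd).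

Lemma copairE U V W (f : {linear U -> W}) (g : {linear V -> W}) x y :
  copair f g (x, y) = f x + g y.
Proof. by []. Qed.

Lemma pair_ex U V W (f : {linear W -> U}) (g : {linear W -> V}) :
  exists h : {linear W -> (U * V)%type}, forall x, h x = (f x, g x).
Proof. by apply: linear_mk => a x y; rewrite !linearP. Qed.

Lemma exact_at0 A B D (f : {linear A -> B}) (g : {linear B -> D}) a :
  exact_at f g -> g (f a) = 0.
Proof. by move=> fg; apply/fg; exists a. Qed.

Definition ses A B D (f : {linear A -> B}) (g : {linear B -> D}) :=
  [/\ inj0 f, surj g & exact_at f g].

Lemma row_comb_ex m M (w : 'I_m -> M) : exists f : {linear 'rV[R]_m -> M},
  forall v, f v = \sum_i v 0 i *: w i.
Proof.
apply: linear_mk => a x y; rewrite scaler_sumr -big_split.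
by apply: eq_bigr => i _ /=; rewrite !mxE scalerDl scalerA.
Qed.

Fact kval_key : unit. Proof. exact: tt. Qed.
(* Locked, so that [/=] does not expose the underlying [val]. *)
Definition kval U V (f : {linear U -> V}) : {linear Ker f -> U} :=
  locked_with kval_key (val : {linear Ker f -> U}).

Lemma kvalE U V (f : {linear U -> V}) x : kval f x = val x.
Proof. by rewrite /kval unlock. Qed.

Lemma kvalP U V (f : {linear U -> V}) x : f (kval f x) = 0.
Proof. by rewrite kvalE; apply/eqP; exact: (valP x). Qed.

Lemma kval_inj U V (f : {linear U -> V}) : inj0 (kval f).
Proof. by move=> x; rewrite kvalE => e; apply: val_inj. Qed.

Lemma kval_ex U V (f : {linear U -> V}) u : f u = 0 -> exists x, kval f x = u.
Proof. by move/eqP=> e; exists (exist _ u e); rewrite kvalE. Qed.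

Lemma ses_ker U V (f : {linear U -> V}) : surj f -> ses (kval f) f.
Proof.
split=> // [|v]; first exact: kval_inj.
by split=> [/kval_ex //|[u <-]]; rewrite kvalP.
Qed.

Lemma ses_split A B : exists f : {linear A -> (A * B)%type}, ses f (snd : {linear (A * B)%type -> B}).
Proof.
have [f fE] := pair_ex (idfun : {linear A -> A}) (\0 : {linear A -> B}).
exists f; split=> [x|y|[x y]].
- by rewrite fE => -[].
- by exists (0, y).
- split=> [/= ->|[u]]; first by exists x; rewrite fE.
  by rewrite fE => -[_ <-].
Qed.

Lemma projective_split A P (p : {linear A -> P}) : projective_module P -> surj p ->
  exists s : {linear P -> A}, forall x, p (s x) = x.
Proof. by move=> Pp ps; have [s] := Pp _ _ p (idfun : {linear P -> P}) ps; exists s. Qed.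

Lemma projective_retract P Q (i : {linear P -> Q}) (r : {linear Q -> P}) :
  cancel i r -> projective_module Q -> projective_module P.
Proof.
move=> irK Qp U V p g psurj.
have [h hE] := Qp U V p (g \o r) psurj.
by exists (h \o i) => x /=; rewrite hE /= irK.
Qed.

Lemma projective_prod P Q : projective_module P -> projective_module Q ->
  projective_module (P * Q)%type.
Proof.
move=> Pp Qp U V p g psurj.
have [i1 i1E] := pair_ex (idfun : {linear P -> P}) (\0 : {linear P -> Q}).
have [i2 i2E] := pair_ex (\0 : {linear Q -> P}) (idfun : {linear Q -> Q}).
have [h1 h1E] := Pp U V p (g \o i1) psurj.
have [h2 h2E] := Qp U V p (g \o i2) psurj.
exists (copair h1 h2) => -[x y]; rewrite copairE linearD h1E h2E /= -linearD.
by rewrite i1E i2E; congr (g (_, _)); rewrite ?addr0 ?add0r.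
Qed.

Lemma projective_ker_split A P (p : {linear A -> P}) :
  projective_module A -> projective_module P -> surj p -> projective_module (Ker p).
Proof.
move=> Ap Pp ps; have [s sE] := projective_split Pp ps.
have [||h hE] := @factor_inj A _ _ (kval p) (idfun \- (s \o p) : {linear A -> A}).
- exact: kval_inj.
- by move=> u; apply: kval_ex; rewrite /= linearB sE subrr.
have hK : cancel (kval p) h.
  move=> x; apply: (inj0_eq (@kval_inj _ _ p)).
  by rewrite hE /= kvalP linear0 subr0.
exact: projective_retract hK Ap.
Qed.

Lemma coker_ex A B (f : {linear A -> B}) :
  exists p : {linear B -> Coker f}, surj p /\ exact_at f p.
Proof.
pose S := GRing.SubmodClosed.clone R B (im_pred f) _.
exists (@lquot_pi R B S); split=> [x|b]; first exact: lquot_pi_surj.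
rewrite -(linear0 (@lquot_pi R B S)) lquot_piP subr0.
by split=> [/asboolP|h]; last apply/asboolP.
Qed.

(** The image of [d] is realized as the kernel of the projection to [Coker d], and [d] is surjective
    onto it. *)
Lemma projective_lift P A B (d : {linear A -> B}) (g : {linear P -> B}) :
  projective_module P -> (forall x, exists a, d a = g x) ->
  exists h : {linear P -> A}, forall x, d (h x) = g x.
Proof.
move=> Pp dg; have [p [_ dp]] := coker_ex d.
have [a|u uE] := @factor_inj _ _ _ (kval p) d (@kval_inj _ _ p).
  by apply: kval_ex; apply/dp; exists a.
have us : surj u.
  move=> z; have /dp[a aE] := kvalP z.
  by exists a; apply: (inj0_eq (@kval_inj _ _ p)); rewrite uE.
have [x|t tE] := @factor_inj _ _ _ (kval p) g (@kval_inj _ _ p).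
  by apply: kval_ex; apply/dp; exact: dg.
have [h hE] := Pp _ _ u t us.
by exists h => x; rewrite -uE hE tE.
Qed.

(* The rotation of [0 -> A -> B -> D -> 0]: the map [A + F -> B] has kernel
   the kernel of [F -> D]. *)
Lemma ses_rotate A B D F (f : {linear A -> B}) (g : {linear B -> D}) (q : {linear F -> D}) :
  ses f g -> projective_module F -> surj q ->
  exists (l : {linear F -> B}) (j : {linear Ker q -> (A * F)%type}),
   [/\ ses j (copair f l), forall x, g (l x) = q x & forall x, (j x).2 = kval q x].
Proof.
move=> [fi gs fg] Fp qs; have [l lE] := Fp _ _ g q gs.
have [x|t tE] := @factor_inj (Ker q) A B f (l \o kval q) fi.
  by apply/fg; rewrite /= lE kvalP.
have [j jE] := pair_ex (\- t : {linear Ker q -> A}) (kval q).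
exists l, j; split=> // [|x]; last by rewrite jE.
split=> [x|b|[a x]].
- by rewrite jE => -[_]; apply: kval_inj.
- have [x xE] := qs (g b).
  have /fg[a aE] : g (b - l x) = 0 by rewrite linearB lE xE subrr.
  by exists (a, x); rewrite copairE aE subrK.
- rewrite copairE; split=> [e|[u]].
    have : q x = 0.
      by have := congr1 g e; rewrite linear0 linearD lE (exact_at0 _ fg) add0r.
    move/kval_ex=> [u uE]; exists u; rewrite jE uE; congr (_, _) => /=.
    apply: (inj0_eq fi); rewrite /= linearN tE /= uE.
    by apply/eqP; rewrite eq_sym -addr_eq0 e.
  by rewrite jE => -[<- <-]; rewrite /= linearN tE /= addNr.
Qed.

End Linear.

(** * Vanishing of Ext and short exact sequences *)

Section ExtVanishing.
Set Implicit Arguments.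
Unset Strict Implicit.
Unset Printing Implicit Defensive.
Import GRing.Theory.
Local Open Scope ring_scope.

Variable R : comNzRingType.
Variable C : lmodType R.
Implicit Types A B D E F K M N P Q U V W : lmodType R.

Definition extends A B (f : {linear A -> B}) :=
  forall h : {linear A -> C}, exists h' : {linear B -> C}, forall a, h' (f a) = h a.

(* [ext_van i M] is the vanishing of Ext^(i+1)(M, C): note the shift. *)
Fixpoint ext_van (i : nat) M : Prop :=
  if i is j.+1 then ext_van j (Ker (res_aug M)) else
  forall A B (f : {linear A -> B}) (g : {linear B -> M}), ses f g -> extends f.

Definition acyclic M := forall i, ext_van i M.

(** As [B] is projective, the second sequence is the pushout of the first along some [t : A -> K].
    So a map on [K] and an extension to [B] of its composite with [t] glue to a map on [E]. *)
Lemma ses_pushout_extend A B K E M (f : {linear A -> B}) (g : {linear B -> M})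
    (k : {linear K -> E}) (q : {linear E -> M}) :
  ses f g -> ses k q -> projective_module B -> extends f -> extends k.
Proof.
move=> [fi gs fg] [ki qs kq] Bp fx h.
have [l lE] := Bp _ _ q g qs.
have [a|t tE] := @factor_inj R _ _ _ k (l \o f) ki.
  by apply/kq; rewrite /= lE; apply/fg; exists a.
have [u uE] := fx (h \o t).
have [||w wE] := @factor_surj R _ _ _ (copair k l) (copair h u).
- move=> e; have [b bE] := gs (q e).
  have /kq[x xE] : q (e - l b) = 0 by rewrite linearB lE bE subrr.
  by exists (x, b); rewrite copairE xE subrK.
- move=> [x b]; rewrite !copairE => e.
  have /fg[a aE] : g b = 0.
    by have := congr1 q e; rewrite linear0 linearD lE (exact_at0 _ kq) ?add0r.
  have -> : x = - t a.
    apply: (inj0_eq ki); apply/eqP; rewrite linearN tE /= aE.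
    by rewrite -addr_eq0 e.
  by rewrite -aE uE /= linearN addNr.
by exists w => x; have := wE (x, 0); rewrite !copairE !linear0 !addr0.
Qed.

Lemma ext_van0_projective A B M (f : {linear A -> B}) (g : {linear B -> M}) :
  ses f g -> projective_module B -> extends f -> ext_van 0 M.
Proof. by move=> fg Bp fx K E k q kq; apply: ses_pushout_extend fg kq Bp fx. Qed.

(** In the rotated sequence, vanishing for [B] extends a map on the syzygy of [M] to [A * F], where
    [F] is the free cover of [M]. The part on [A], extended along [f], then corrects it to a map on
    [F] alone. *)
Lemma ext_van0_extend A B M (f : {linear A -> B}) (g : {linear B -> M}) :
  ses f g -> ext_van 0 B -> extends f -> ext_van 0 M.
Proof.
move=> fg B0 fx; have Fp := @res_mod_projective R M 0.
have [l [j [jl lE jE]]] := ses_rotate fg Fp (@res_aug_surj R M).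
have [fi gs fgx] := fg; have [_ _ jlx] := jl.
apply: (ext_van0_projective (ses_ker (@res_aug_surj R M))) => // h.
have [w wE] := B0 _ _ _ _ jl h.
have [i1 i1E] := pair_ex (idfun : {linear A -> A}) (\0 : {linear A -> res_mod M 0}).
have [i2 i2E] := pair_ex (\0 : {linear res_mod M 0 -> A}) (idfun : {linear res_mod M 0 -> _}).
have [u uE] := fx (w \o i1).
exists ((w \o i2) \- (u \o l)) => x; rewrite /= -wE -jE.
have /jlx : exists v, j v = j x by exists x.
case: (j x) => a b; rewrite copairE /= => /eqP; rewrite addrC addr_eq0 => /eqP ->.
rewrite linearN uE opprK /= -linearD; congr (w _).
by rewrite i1E i2E; congr (_, _); rewrite /= ?add0r ?addr0.
Qed.

Lemma ext_van_proj i P : projective_module P -> ext_van i P.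
Proof.
elim: i P => [|i IH] P Pp; last first.
  by apply: IH; apply: projective_ker_split => //; [exact: res_mod_projective|exact: res_aug_surj].
move=> A B f g [fi gs fg] h.
have [s sE] := projective_split Pp gs.
have [b|t tE] := @factor_inj R _ _ _ f (idfun \- (s \o g)) fi.
  by apply/fg; rewrite /= linearB sE subrr.
exists (h \o t) => a /=; congr (h _); apply: (inj0_eq fi).
by rewrite tE /= (exact_at0 _ fg) linear0 subr0.
Qed.

(** In an extension [E] of [B] by [K], the part over [A] is an extension of [A] by [K], to which [h]
    extends. It is also the kernel of [E -> D], so the new map extends to [E]. *)
Lemma ext_van0_mid A B D (f : {linear A -> B}) (g : {linear B -> D}) :
  ses f g -> ext_van 0 A -> ext_van 0 D -> ext_van 0 B.
Proof.
move=> [fi gs fg] A0 D0 K E k q [ki qs kq] h.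
pose gq : {linear E -> D} := g \o q.
have gqs : surj gq.
  by move=> d; have [b <-] := gs d; have [e <-] := qs b; exists e.
have [e|r rE] := @factor_inj R (Ker gq) _ _ f (q \o kval gq) fi.
  by apply/fg; exact: (kvalP e).
have [x|k' k'E] := @factor_inj R K _ _ (kval gq) k (@kval_inj R _ _ gq).
  by apply: kval_ex; rewrite /= (exact_at0 _ kq) ?linear0.
have kr : ses k' r.
  split=> [x e|a|e].
  - by apply: ki; rewrite -k'E e linear0.
  - have [e eE] := qs (f a).
    have [|z zE] := @kval_ex R _ _ gq e.
      by rewrite /= eE; apply/fg; exists a.
    by exists z; apply: (inj0_eq fi); rewrite rE /= zE.
  - split=> [e0|[x <-]].
      have /kq[x xE] : q (kval gq e) = 0.
        by have := rE e; rewrite e0 linear0.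
      by exists x; apply: (inj0_eq (@kval_inj R _ _ gq)); rewrite k'E.
    by apply: fi; rewrite rE /= k'E; apply/kq; exists x.
have [u uE] := A0 _ _ _ _ kr h.
have [v vE] := D0 _ _ _ _ (ses_ker gqs) u.
by exists v => x; rewrite -k'E vE uE.
Qed.

Lemma ext_van0_retract A B (i : {linear A -> B}) (r : {linear B -> A}) :
  cancel i r -> ext_van 0 B -> ext_van 0 A.
Proof.
move=> irK B0 K E k q [ki qs kq] h.
(* [Ker m] is the fibre product of [E] and [B] over [A], that is, the pullback of the extension
   along [r]. *)
pose m : {linear (E * B)%type -> A} := (q \o fst) \- (r \o snd).
pose p : {linear Ker m -> B} := snd \o kval m.
have mE z : q (kval m z).1 = r (kval m z).2.
  by apply/eqP; rewrite -subr_eq0; apply/eqP; exact: (kvalP z).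
have [k0 k0E] := pair_ex k (\0 : {linear K -> B}).
have [x|k' k'E] := @factor_inj R K _ _ (kval m) k0 (@kval_inj R _ _ m).
  by apply: kval_ex; rewrite k0E /= linear0 subr0; apply/kq; exists x.
have kp : ses k' p.
  split=> [x e|b|z].
  - by apply: ki; have := k'E x; rewrite e linear0 k0E => -[].
  - have [e eE] := qs (r b).
    have [|z zE] := @kval_ex R _ _ m (e, b); first by rewrite /= eE subrr.
    by exists z; rewrite /= zE.
  - split=> [/= z2|[x <-]]; last by rewrite /= k'E k0E.
    have /kq[x xE] : q (kval m z).1 = 0 by rewrite mE z2 linear0.
    exists x; apply: (inj0_eq (@kval_inj R _ _ m)); rewrite k'E k0E xE /= -z2.
    by case: (kval m z).
have [u uE] := B0 _ _ _ _ kp h.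
have [j0 j0E] := pair_ex (idfun : {linear E -> E}) (i \o q).
have [e|j jE] := @factor_inj R E _ _ (kval m) j0 (@kval_inj R _ _ m).
  by apply: kval_ex; rewrite j0E /= irK subrr.
exists (u \o j) => x /=; rewrite -uE; congr (u _).
apply: (inj0_eq (@kval_inj R _ _ m)); rewrite jE k'E j0E k0E /=.
by rewrite (exact_at0 _ kq) ?linear0.
Qed.

(* The three vanishing statements of the long exact sequence are proved by one
   induction on the degree: rotating the sequence turns [right_at i] into
   [left_at i], [left_at i] into [mid_at i], and [mid_at i.+1] into [right_at i]. *)
Let mid_at i := forall A B D (f : {linear A -> B}) (g : {linear B -> D}),
  ses f g -> ext_van i A -> ext_van i D -> ext_van i B.
Let summand_at i := forall A F, projective_module F -> ext_van i (A * F)%type -> ext_van i A.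
Let left_at i := forall A B D (f : {linear A -> B}) (g : {linear B -> D}),
  ses f g -> ext_van i B -> ext_van i.+1 D -> ext_van i A.
Let right_at i := forall A B D (f : {linear A -> B}) (g : {linear B -> D}),
  ses f g -> ext_van i A -> ext_van i.+1 B -> ext_van i.+1 D.

Let summand0 : summand_at 0.
Proof.
move=> A F Fp; have [i1 i1E] := pair_ex (idfun : {linear A -> A}) (\0 : {linear A -> F}).
by apply: (@ext_van0_retract _ _ i1 fst) => x; rewrite i1E.
Qed.

Let prod_projective_of_mid i A F : mid_at i -> projective_module F ->
  ext_van i A -> ext_van i (A * F)%type.
Proof.
move=> g Fp Ai; have [f fs] := ses_split A F.
by apply: (g _ _ _ _ _ fs) => //; apply: ext_van_proj.
Qed.

Let left_of_mid i : mid_at i -> summand_at i -> left_at i.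
Proof.
move=> g s A B D f p fp Bi Di; have Fp := @res_mod_projective R D 0.
have [l [j [jl _ _]]] := ses_rotate fp Fp (@res_aug_surj R D).
exact: s Fp (g _ _ _ _ _ jl Di Bi).
Qed.

Let right_of_left i : mid_at i -> left_at i -> right_at i.
Proof.
move=> g a A B D f p fp Ai Bi; have Fp := @res_mod_projective R D 0.
have [l [j [jl _ _]]] := ses_rotate fp Fp (@res_aug_surj R D).
by apply: (a _ _ _ _ _ jl) => //; apply: prod_projective_of_mid.
Qed.

Let summandS i : right_at i -> summand_at i.+1.
Proof.
move=> b A F Fp AF.
have [f fE] := pair_ex (\0 : {linear F -> A}) (idfun : {linear F -> F}).
have fs : ses f (fst : {linear (A * F)%type -> A}).
  split=> [x|x|[x y]]; first by rewrite fE => -[].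
    by exists (x, 0).
  split=> [/= ->|[u]]; first by exists y; rewrite fE.
  by rewrite fE => -[<- _].
by apply: (b _ _ _ _ _ fs) => //; apply: ext_van_proj.
Qed.

(** [A] and [A * F] have a common first syzygy: add the identity of [F] to the cover of [A]. *)
Let prod_projectiveS i A F : right_at i -> projective_module F ->
  ext_van i.+1 A -> ext_van i.+1 (A * F)%type.
Proof.
move=> b Fp AS; have Qp := @res_mod_projective R A 0.
pose q := res_aug A; have qs := @res_aug_surj R A.
have [j jE] := pair_ex (kval q) (\0 : {linear Ker q -> F}).
have [p pE] := pair_ex (q \o fst : {linear (res_mod A 0 * F)%type -> A}) snd.
have jp : ses j p.
  split=> [x|[x y]|[x y]].
  - by rewrite jE => -[]; apply: kval_inj.
  - by have [z zE] := qs x; exists (z, y); rewrite pE /= zE.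
  - split; rewrite pE.
      by move=> -[/kval_ex[z zE] /= ->]; exists z; rewrite jE zE.
    by move=> [z]; rewrite jE => -[<- <-]; rewrite /= kvalP.
by apply: (b _ _ _ _ _ jp) => //; apply: ext_van_proj; apply: projective_prod.
Qed.

Let midS i : right_at i -> mid_at i.+1.
Proof.
move=> b A B D f p fp AS DS; have Fp := @res_mod_projective R D 0.
have [l [j [jl _ _]]] := ses_rotate fp Fp (@res_aug_surj R D).
by apply: (b _ _ _ _ _ jl) => //; apply: prod_projectiveS.
Qed.

Let les i : [/\ mid_at i, left_at i & right_at i].
Proof.
suff: [/\ mid_at i, summand_at i & right_at i].
  by move=> [g s b]; split=> //; apply: left_of_mid.
elim: i => [|i [g s b]].
  have g0 : mid_at 0 := ext_van0_mid; have s0 := summand0.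
  by split=> //; apply/right_of_left/left_of_mid.
have gS := midS b; have sS := summandS b.
by split=> //; apply/right_of_left/left_of_mid.
Qed.

Lemma ext_van_mid i A B D (f : {linear A -> B}) (g : {linear B -> D}) :
  ses f g -> ext_van i A -> ext_van i D -> ext_van i B.
Proof. by case: (les i) => h _ _; exact: h. Qed.

Lemma ext_van_left i A B D (f : {linear A -> B}) (g : {linear B -> D}) :
  ses f g -> ext_van i B -> ext_van i.+1 D -> ext_van i A.
Proof. by case: (les i) => _ h _; exact: h. Qed.

Lemma ext_van_right i A B D (f : {linear A -> B}) (g : {linear B -> D}) :
  ses f g -> ext_van i A -> ext_van i.+1 B -> ext_van i.+1 D.
Proof. by case: (les i) => _ _; exact. Qed.

Lemma ext_van_shift i A B D (f : {linear A -> B}) (g : {linear B -> D}) :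
  ses f g -> acyclic B -> ext_van i.+1 D <-> ext_van i A.
Proof.
move=> fg B0; split; first exact: ext_van_left fg (B0 i).
by move=> Ai; apply: ext_van_right fg Ai (B0 _).
Qed.

Lemma ext_van0_ses A B D (f : {linear A -> B}) (g : {linear B -> D}) :
  ses f g -> acyclic B -> ext_van 0 D <-> extends f.
Proof.
move=> fg B0; split=> [D0|]; first exact: D0 fg.
exact: ext_van0_extend fg (B0 0).
Qed.

Lemma acyclic_projective P : projective_module P -> acyclic P.
Proof. by move=> Pp i; apply: ext_van_proj. Qed.

Lemma acyclic_prod A B : acyclic A -> acyclic B -> acyclic (A * B)%type.
Proof.
move=> A0 B0 i; have [f fs] := ses_split A B.
exact: ext_van_mid fs (A0 i) (B0 i).
Qed.

(** [Ker r] is again a retract of [B], so the induction on the degree runs over all retracts of [B]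
    at once. *)
Lemma acyclic_retract A B (i : {linear A -> B}) (r : {linear B -> A}) :
  cancel i r -> acyclic B -> acyclic A.
Proof.
move=> irK B0 n; elim: n A i r irK => [|n IH] A i r irK.
  exact: ext_van0_retract irK (B0 0).
have rs : surj r by move=> a; exists (i a).
have rk := ses_ker rs.
have [x|t tE] := @factor_inj R B _ _ (kval r) (idfun \- (i \o r)) (@kval_inj R _ _ r).
  by apply: kval_ex; rewrite /= linearB irK subrr.
apply: ext_van_right rk _ (B0 _); apply: (IH _ (kval r) t) => x.
by apply: (inj0_eq (@kval_inj R _ _ r)); rewrite tE /= kvalP linear0 subr0.
Qed.

(** For a positive index [ext_van] refers to one particular free cover, so invariance is drawn from
    the exact sequence with kernel 0. *)
Lemma ext_van_iso i A B (f : {linear A -> B}) (g : {linear B -> A}) :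
  cancel f g -> cancel g f -> ext_van i A <-> ext_van i B.
Proof.
have half U V (h : {linear U -> V}) (k : {linear V -> U}) :
    cancel h k -> cancel k h -> ext_van i U -> ext_van i V.
  move=> hK kK Ui; case: i Ui => [|j] Uj; first exact: ext_van0_retract kK Uj.
  have hs : surj h by move=> y; exists (k y).
  apply: (ext_van_right (ses_ker hs)) => //.
  apply: ext_van_proj => U' V' q l qs; exists \0 => x.
  suff -> : x = 0 by rewrite !linear0.
  by apply: (@kval_inj R _ _ h); rewrite -(hK (kval h x)) kvalP linear0.
by move=> fK gK; split; [exact: half fK gK|exact: half gK fK].
Qed.

(** Dimension shifting: the maps after [d 0] resolve the syzygy [Ker e], and for [i = 0] the
    cocycles on [P 1] are the maps on [Ker e]. *)
Lemma ext_van_resolution i (P : nat -> lmodType R)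
    (d : forall j, {linear P j.+1 -> P j}) M (e : {linear P 0 -> M}) :
  surj e -> exact_at (d 0) e -> (forall j, exact_at (d j.+1) (d j)) ->
  (forall j, acyclic (P j)) ->
  ext_van i M <-> forall c : {linear P i.+1 -> C}, (forall x, c (d i.+1 x) = 0) ->
     exists b : {linear P i -> C}, forall x, b (d i x) = c x.
Proof.
elim: i P d M e => [|i IH] P d M e es e0 eS Pa.
  rewrite (ext_van0_ses (ses_ker es)) //.
  have [x|t tE] := @factor_inj R _ _ _ (kval e) (d 0) (@kval_inj R _ _ e).
    by apply: kval_ex; apply/e0; exists x.
  have ts : surj t.
    move=> z; have /e0[x xE] := kvalP z.
    by exists x; apply: (inj0_eq (@kval_inj R _ _ e)); rewrite tE.
  have tk x : t x = 0 <-> d 0 x = 0.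
    by rewrite -tE; split=> [->|/kval_inj //]; rewrite linear0.
  split=> [ex c c0|cb h].
    have [x /tk/eS[y <-]|h hE] := @factor_surj R _ _ _ t c ts; first by rewrite c0.
    by have [b bE] := ex h; exists b => x; rewrite -tE bE hE.
  have [x|b bE] := cb (h \o t).
    by rewrite /= (proj2 (tk _)) ?linear0 //; apply/eS; exists x.
  by exists b => z; have [x <-] := ts z; rewrite tE bE.
rewrite (ext_van_shift _ (ses_ker es)) //.
have [x|t tE] := @factor_inj R _ _ _ (kval e) (d 0) (@kval_inj R _ _ e).
  by apply: kval_ex; apply/e0; exists x.
have ts : surj t.
  move=> z; have /e0[x xE] := kvalP z.
  by exists x; apply: (inj0_eq (@kval_inj R _ _ e)); rewrite tE.
have tk x : t x = 0 <-> d 0 x = 0.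
  by rewrite -tE; split=> [->|/kval_inj //]; rewrite linear0.
apply: (IH (fun j => P j.+1) (fun j => d j.+1) _ t) => // x.
by rewrite tk; exact: eS.
Qed.

End ExtVanishing.

(** * Ext modules and acyclic resolutions *)

Section ExtModule.
Set Implicit Arguments.
Unset Strict Implicit.
Unset Printing Implicit Defensive.
Import GRing.Theory.
Local Open Scope ring_scope.

Variable R : comNzRingType.
Implicit Types A B C D E F K M N P Q U V W : lmodType R.

Lemma homology_proj U V W (f : {linear U -> V}) (g : {linear V -> W}) :
  exists p : {linear Ker g -> homology f g},
    surj p /\ forall z, p z = 0 <-> exists u, f u = kval g z.
Proof.
exists (@lquot_pi R (Ker g) (GRing.SubmodClosed.clone R (Ker g) (bnd_pred f (g := g)) _)).
split=> [x|z]; first exact: lquot_pi_surj.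
rewrite -(linear0 (@lquot_pi R (Ker g) (GRing.SubmodClosed.clone R (Ker g) (bnd_pred f (g := g)) _))).
by rewrite lquot_piP subr0 kvalE; split=> [/asboolP|h]; last apply/asboolP.
Qed.

Lemma zero_Ext0 M C : zero_module (Ext 0 M C) <-> forall (h : {linear M -> C}) x, h x = 0.
Proof.
split=> [z h x|z].
  have [|u uE] := @kval_ex R _ _ (dual C (res_d M 0)) (dual C (res_aug M) h).
    by apply/Hom_eqP => y /=; rewrite (exact_at0 _ (@res_exact0 R M)) linear0.
  have [y <-] := @res_aug_surj R M x.
  have := (Hom_eqP _ _).2 uE y; rewrite [RHS]/= => <-.
  by rewrite [u]z linear0.
move=> u; apply: (@kval_inj R _ _ (dual C (res_d M 0))); apply/Hom_eqP => y.
have [x|h hE] := @factor_surj R _ _ _ (res_aug M) (kval _ u) (@res_aug_surj R M).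
  move=> /res_exact0[w <-].
  exact: (proj2 (Hom_eqP _ _) (kvalP u) w).
by rewrite -hE z.
Qed.

Lemma zero_ExtS_cocycle i M C : zero_module (Ext i.+1 M C) <->
  forall c : {linear res_mod M i.+1 -> C}, (forall x, c (res_d M i.+1 x) = 0) ->
     exists b : {linear res_mod M i -> C}, forall x, b (res_d M i x) = c x.
Proof.
have [p [ps pE]] := homology_proj (dual C (res_d M i)) (dual C (res_d M i.+1)).
split=> [z c c0|h x].
  have [|u uE] := @kval_ex R _ _ (dual C (res_d M i.+1)) c.
    by apply/Hom_eqP => y; exact: c0.
  have /pE[b bE] : p u = 0 by apply: z.
  by exists b => x; rewrite uE in bE; exact: (proj2 (Hom_eqP _ _) bE x).
have [u <-] := ps x; apply/pE.
have [y|b bE] := h (kval (dual C (res_d M i.+1)) u).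
  exact: (proj2 (Hom_eqP _ _) (kvalP u) y).
by exists b; apply/Hom_eqP => y; exact: bE.
Qed.

Lemma zero_ExtS i M C : zero_module (Ext i.+1 M C) <-> ext_van C i M.
Proof.
rewrite zero_ExtS_cocycle; apply: iff_sym.
apply: (ext_van_resolution _ (@res_aug_surj R M) (@res_exact0 R M) (@res_exactS R M)).
by move=> j; apply: acyclic_projective; apply: res_mod_projective.
Qed.

Lemma acyclicP M C : acyclic C M <-> forall i, (0 < i)%N -> zero_module (Ext i M C).
Proof.
by split=> [a [//|i] _|z i]; [apply/zero_ExtS; apply: a|apply/zero_ExtS; apply: z].
Qed.

Lemma dep_choice (T : nat -> Type) (G : forall i, T i -> Prop)
    (Q : forall i, T i -> T i.+1 -> Prop) (t0 : T 0) :
  G 0 t0 -> (forall i t, G i t -> exists t', G i.+1 t' /\ Q i t t') ->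
  exists f : forall i, T i, f 0 = t0 /\ forall i, Q i (f i) (f i.+1).
Proof.
move=> G0 GS.
pose s i (p : {t | G i t}) : {t' | G i.+1 t' /\ Q i (sval p) t'} :=
  cid (GS i (sval p) (proj2_sig p)).
pose f := fix f i : {t : T i | G i t} :=
  if i is j.+1 then exist _ (sval (s j (f j))) (proj2_sig (s j (f j))).1
  else exist _ t0 G0.
exists (fun i => sval (f i)); split=> // i.
exact: (proj2_sig (s i (f i))).2.
Qed.

Section ChainMap.
Variables (M : lmodType R) (F X : nat -> lmodType R).
Variables (dF : forall i, {linear F i.+1 -> F i}) (eF : {linear F 0 -> M}).
Variables (dX : forall i, {linear X i.+1 -> X i}) (eX : {linear X 0 -> M}).
Hypothesis F0 : exact_at (dF 0) eF.
Hypothesis FS : forall i, exact_at (dF i.+1) (dF i).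
Hypotheses (eXs : surj eX) (X0 : exact_at (dX 0) eX).
Hypothesis XS : forall i, exact_at (dX i.+1) (dX i).

Lemma chain_map_ex : (forall i, projective_module (F i)) ->
  exists phi : forall i, {linear F i -> X i},
    (forall x, eX (phi 0 x) = eF x) /\
    (forall i x, dX i (phi i.+1 x) = phi i (dF i x)).
Proof.
move=> Fp; have [p0 p0E] := Fp 0 _ _ eX eF eXs.
(* [G] says that cycles go to cycles, which is what the next lifting requires. *)
pose G i : {linear F i -> X i} -> Prop :=
  match i return ({linear F i -> X i} -> Prop) with
  | 0 => fun phi => forall x, eF x = 0 -> eX (phi x) = 0
  | j.+1 => fun phi => forall x, dF j x = 0 -> dX j (phi x) = 0
  end.
pose Q i (phi : {linear F i -> X i}) (psi : {linear F i.+1 -> X i.+1}) :=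
  forall x, dX i (psi x) = phi (dF i x).
have G0 : G 0 p0 by move=> x x0; rewrite p0E.
have [|phi [phi0 phiS]] := dep_choice (T := fun i => {linear F i -> X i}) (Q := Q) G0.
  move=> i phi Gi; have [x|psi psiE] := projective_lift (d := dX i) (g := phi \o dF i) (Fp i.+1).
    case: i phi Gi x => [|i] phi Gi x.
      by apply/X0; apply: Gi; apply/F0; exists x.
    by apply/XS; apply: Gi; apply/FS; exists x.
  by exists psi; split=> [x x0|//]; rewrite psiE /= x0 linear0.
by exists phi; split=> // x; rewrite phi0.
Qed.

End ChainMap.

(** A mapping cone is exact where both complexes are. The outgoing map [k] enters only through its
    kernel, so that the truncated end of the cone is covered too. *)
Lemma cone_exact (X3 X2 X1 F2 F1 F0 W : lmodType R) (d1 : {linear X3 -> X2}) (d0 : {linear X2 -> X1})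
    (p2 : {linear F2 -> X2}) (p1 : {linear F1 -> X1})
    (r1 : {linear F2 -> F1}) (r0 : {linear F1 -> F0})
    (k : {linear (X2 * F1)%type -> W}) (D : {linear (X3 * F2)%type -> (X2 * F1)%type}) :
  (forall x y, k (x, y) = 0 <-> d0 x + p1 y = 0 /\ r0 y = 0) ->
  (forall x y, D (x, y) = (d1 x + p2 y, - r1 y)) ->
  exact_at r1 r0 -> exact_at d1 d0 -> (forall y, d0 (p2 y) = p1 (r1 y)) ->
  exact_at D k.
Proof.
move=> kE DE r10 d10 pp [x y]; rewrite kE; split=> [[xy /r10[z zE]]|[[u v]]].
  have /d10[w wE] : d0 (x + p2 z) = 0 by rewrite linearD pp zE.
  by exists (w, - z); rewrite DE wE !linearN opprK zE addrK.
rewrite DE => -[<- <-]; rewrite !linearN (exact_at0 _ r10) oppr0; split=> //.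
by rewrite linearD (exact_at0 _ d10) add0r pp subrr.
Qed.

(** * Ext computed from a resolution by acyclic modules *)

Section ExtCoker.
Variables (C M : lmodType R) (X : nat -> lmodType R).
Variables (d : forall i, {linear X i.+1 -> X i}) (e : {linear X 0 -> M}).
Hypotheses (es : surj e) (X0 : exact_at (d 0) e).
Hypothesis XS : forall i, exact_at (d i.+1) (d i).
Hypothesis Xa : forall i, acyclic C (X i).

Let F := res_mod M.
Let r := res_d M.

(* The mapping cone of a comparison map from the standard resolution of [M] to
   [X], truncated so as to resolve [X 0], stays exact after [Hom(-, C)]. *)
Lemma comparison_ex : exists phi : forall i, {linear F i -> X i},
  [/\ forall i x, d i (phi i.+1 x) = phi i (r i x),
     forall i (g : {linear X i.+1 -> C}) (c : {linear F i -> C}),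
       (forall x, g (d i.+1 x) = 0) -> (forall y, g (phi i.+1 y) = c (r i y)) ->
       exists b : {linear X i -> C}, forall x, b (d i x) = g x
   & forall i (c : {linear F i.+1 -> C}), (forall y, c (r i.+1 y) = 0) ->
       exists (g : {linear X i.+1 -> C}) (b : {linear F i -> C}),
         (forall x, g (d i.+1 x) = 0) /\ (forall y, g (phi i.+1 y) - b (r i y) = c y)].
Proof.
have [phi [phi0 phiS]] := chain_map_ex (@res_exact0 R M) (@res_exactS R M) es X0 XS
  (@res_mod_projective R M).
pose P i : lmodType R := (X i.+1 * F i)%type.
pose E : {linear P 0 -> X 0} := copair (d 0) (phi 0).
have [D DE] : exists D : forall i, {linear P i.+1 -> P i},
    forall i x y, D i (x, y) = (d i.+1 x + phi i.+1 y, - r i y).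
  have h i : exists D : {linear P i.+1 -> P i},
      forall z, D z = (copair (d i.+1) (phi i.+1) z, (\- (r i \o snd) : {linear P i.+1 -> F i}) z).
    exact: pair_ex.
  exists (fun i => sval (cid (h i))) => i x y.
  by rewrite (proj2_sig (cid (h i))).
have Es : surj E.
  move=> z; have [y yE] := @res_aug_surj R M (e z).
  have /X0[x xE] : e (z - phi 0 y) = 0 by rewrite linearB phi0 yE subrr.
  by exists (x, y); rewrite copairE xE subrK.
have E0 : exact_at (D 0) E.
  apply: (cone_exact (r0 := res_aug M) (d0 := d 0) (p1 := phi 0) _ (DE 0) (@res_exact0 R M) (@XS 0) (phiS 0)).
  move=> x y; rewrite copairE; split=> [h|[]//]; split=> //.
  by rewrite -phi0; have := congr1 e h; rewrite linearD (exact_at0 _ X0) add0r linear0.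
have ES i : exact_at (D i.+1) (D i).
  apply: (cone_exact (r0 := r i) (d0 := d i.+1) (p1 := phi i.+1) _ (DE i.+1) (@res_exactS R M i) (@XS i.+1) (phiS i.+1)).
  move=> x y; rewrite DE; split=> [[-> /eqP]|[-> ->]]; last by rewrite oppr0.
  by rewrite oppr_eq0 => /eqP.
have Pa i : acyclic C (P i).
  by apply: acyclic_prod => //; apply: acyclic_projective; apply: res_mod_projective.
(* As [X 0] is acyclic, Hom(-, C) keeps its resolution [P] exact. *)
have PE i := (ext_van_resolution i Es E0 ES Pa).1 (@Xa 0 i).
have [in1 in1E] : exists j : forall i, {linear X i.+1 -> P i}, forall i x, j i x = (x, 0).
  have h i := @pair_ex R _ _ _ (idfun : {linear X i.+1 -> X i.+1}) (\0 : {linear X i.+1 -> F i}).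
  by exists (fun i => sval (cid (h i))) => i x; rewrite (proj2_sig (cid (h i))).
have [in2 in2E] : exists j : forall i, {linear F i -> P i}, forall i x, j i x = (0, x).
  have h i := @pair_ex R _ _ _ (\0 : {linear F i -> X i.+1}) (idfun : {linear F i -> F i}).
  by exists (fun i => sval (cid (h i))) => i x; rewrite (proj2_sig (cid (h i))).
(* These are injectivity and surjectivity on cohomology in degree [i.+1]. In the first, [(g, c)] is
   a cocycle on [P i]; for [i = 0] it descends along [E] to a map on [X 0]. *)
exists phi; split=> // [i g c gd gc|i c cr].
  have k z : copair g c (D i z) = 0.
    by case: z => x y; rewrite DE copairE linearD linearN gd add0r gc subrr.
  case: i g c gd gc k => [|i] g c gd gc k.
    have [z /E0[w <-]|b bE] := @factor_surj R _ _ _ E (copair g c) Es; first exact: k.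
    by exists b => x; have := bE (x, 0); rewrite !copairE !linear0 !addr0.
  have [b bE] := PE i (copair g c) k.
  exists (b \o in1 i) => x; rewrite /= in1E.
  by have := bE (x, 0); rewrite DE copairE !linear0 !addr0.
have [[x y]|b bE] := PE i (c \o snd : {linear P i.+1 -> C}).
  by rewrite DE /= linearN cr oppr0.
exists (b \o in1 i), (b \o in2 i); split=> [x|y]; rewrite /= in1E.
  by have := bE (x, 0); rewrite DE /= !linear0 addr0.
rewrite in2E -linearB; have := bE (0, y); rewrite DE /= linear0 add0r => <-.
by congr (b (_, _)); rewrite /= ?subr0 ?sub0r.
Qed.

(** As [X n.+2] is zero, every map on [X n.+1] is a cocycle, so the top cohomology of Hom(X, C) is a
    cokernel; [comparison_ex] identifies it with [Ext]. *)
Lemma Ext_coker n : zero_module (X n.+2) ->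
  exists t : {linear Hom (X n.+1) C -> Ext n.+1 M C}, surj t /\ exact_at (dual C (d n)) t.
Proof.
move=> Xz; have [phi [phiS inj sur]] := comparison_ex.
have [p [ps pE]] := homology_proj (dual C (res_d M n)) (dual C (res_d M n.+1)).
have [g|t tE] := @factor_inj R _ _ _ (kval (dual C (res_d M n.+1))) (dual C (phi n.+1)) (@kval_inj R _ _ _).
  apply: kval_ex; apply/Hom_eqP => y /=.
  by rewrite -/(r n.+1) -phiS [phi n.+2 y]Xz !linear0.
exists (p \o t); split=> [x|g].
  have [z <-] := ps x.
  have [y|g [b [gd gb]]] := sur n (kval (dual C (res_d M n.+1)) z).
    exact: (proj2 (Hom_eqP _ _) (kvalP z) y).
  exists g; apply/eqP; rewrite -subr_eq0 /= -linearB; apply/eqP/pE.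
  exists b; rewrite linearB tE; apply/Hom_eqP => y /=.
  by rewrite -gb opprB addrC subrK.
rewrite /= pE tE; split=> [[c cE]|[b <-]].
  have [x|y|b bE] := inj n g c; first by rewrite [x]Xz !linear0.
    by have := proj2 (Hom_eqP _ _) cE y.
  by exists b; apply/Hom_eqP => x; exact: bE.
exists (dual C (phi n) b); apply/Hom_eqP => y /=.
by rewrite phiS.
Qed.

End ExtCoker.
End ExtModule.

(** * Transposes and biduality *)

Section Transpose.
Set Implicit Arguments.
Unset Strict Implicit.
Unset Printing Implicit Defensive.
Import GRing.Theory.
Local Open Scope ring_scope.

Variable R : comNzRingType.
Variable C : lmodType R.
Implicit Types A B D E F K M N P Q T U V W X : lmodType R.

Definition bidual_inj M := forall x : M, (forall f : {linear M -> C}, f x = 0) -> x = 0.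

Definition bidual_surj M := forall g : {linear Hom M C -> C},
  exists x : M, forall f : Hom M C, g f = f x.

(** The properties needed of the terms of a presentation when its transpose is studied. They are
    shared by totally C-reflexive modules and, for semidualizing [C], by finite projective ones. *)
Definition bidual_acyclic M := [/\ bidual_inj M, bidual_surj M & acyclic C (Hom M C)].

Lemma bidual_inj_eq M (x y : M) : bidual_inj M ->
  (forall f : {linear M -> C}, f x = f y) -> x = y.
Proof.
move=> i e; apply/eqP; rewrite -subr_eq0; apply/eqP/i => f.
by rewrite linearB e subrr.
Qed.

Lemma totally_reflexive_bidual X : totally_reflexive C X -> bidual_acyclic X.
Proof.
move=> [_ [ev evK evK'] _ Xa]; split; last exact/acyclicP.
- move=> x fx; rewrite -(evK x) -(evK 0); congr (ev _); apply/Hom_eqP => f.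
  by rewrite /biduality /= /eval_fun fx linear0.
- by move=> g; exists (ev g) => f; rewrite -[in LHS](evK' g).
Qed.

(** * The transpose of a presentation *)

Section Presentation.
Variables (X1 X0 M T : lmodType R) (d : {linear X1 -> X0}) (p : {linear X0 -> M}).
Variable pi : {linear Hom X1 C -> T}.
Hypotheses (n1 : bidual_acyclic X1) (n0 : bidual_acyclic X0).
Hypotheses (ps : surj p) (dp : exact_at d p).
Hypotheses (pis : surj pi) (dpi : exact_at (dual C d) pi).

(** [Ker pi] is the image of [dual C d]; the rest is left exactness of Hom(-, C). *)
Lemma transpose_ses : exists q : {linear Hom X0 C -> Ker pi},
  (forall f, kval pi (q f) = dual C d f) /\ ses (dual C p) q.
Proof.
have [f|q qE] := @factor_inj R _ _ _ (kval pi) (dual C d) (@kval_inj R _ _ pi).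
  by apply: kval_ex; apply: (exact_at0 _ dpi).
exists q; split=> //; split=> [f fp|z|f].
- apply/Hom_eqP => m; have [x <-] := ps m.
  exact: (proj2 (Hom_eqP _ _) fp x).
- have /dpi[f fE] := kvalP z; exists f.
  by apply: (inj0_eq (@kval_inj R _ _ pi)); rewrite qE.
- split=> [q0|[g <-]].
    have [x /dp[y <-]|g gE] := @factor_surj R _ _ _ p f ps; last first.
      by exists g; apply/Hom_eqP => x; exact: gE.
    have := qE f; rewrite q0 linear0 => e.
    by have := proj2 (Hom_eqP _ _) e y; rewrite /= => <-.
  apply: kval_inj; rewrite qE; apply/Hom_eqP => y.
  by rewrite /= (exact_at0 _ dp) linear0.
Qed.

(** By biduality, a map from [Ker pi] to [C] is given by some [x] in [X0] such that every map
    [M -> C] kills [p x]. It extends to [Hom X1 C] exactly when [x] is in the image of [d], that is,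
    when [p x = 0]. *)
Lemma transpose_van0 : ext_van C 0 T <-> bidual_inj M.
Proof.
have [q [qE [_ qs pq]]] := transpose_ses.
have [_ s1 a1] := n1; have [i0 s0 _] := n0.
rewrite (ext_van0_ses (ses_ker pis) a1); split=> [ex m fm|Mi h].
  have [x xE] := ps m.
  have [f /pq[g <-]|h hE] := @factor_surj R _ _ _ q (biduality C x) qs.
    by rewrite /biduality /eval_fun /= xE fm.
  have [h' h'E] := ex h; have [y yE] := s1 h'.
  suff e : x = d y by rewrite -xE e (exact_at0 _ dp).
  apply: (bidual_inj_eq i0) => f.
  by rewrite -[LHS]hE -h'E qE yE.
have [x xE] := s0 (h \o q).
have /dp[y yE] : p x = 0.
  apply: Mi => f; have := xE (dual C p f); rewrite /= => <-.
  by rewrite (exact_at0 _ pq) linear0.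
exists (biduality C y) => z; have [f <-] := qs z.
by rewrite qE /biduality /= /eval_fun /= yE -xE.
Qed.

(** After a shift to [Ker pi], the condition is that each map [Hom M C -> C] extends to [Hom X0 C].
    The extension is evaluation at an element of [X0], so the map is evaluation at its image in
    [M]. *)
Lemma transpose_van1 : ext_van C 1 T <-> bidual_surj M.
Proof.
have [q [qE sq]] := transpose_ses.
have [_ s1 a1] := n1; have [i0 s0 a0] := n0.
rewrite (ext_van_shift _ (ses_ker pis) a1) (ext_van0_ses sq a0).
split=> [ex g|Ms g].
  have [g' g'E] := ex g; have [x xE] := s0 g'.
  by exists (p x) => f; rewrite -g'E xE.
have [m mE] := Ms g; have [x xE] := ps m.
by exists (biduality C x) => f; rewrite mE /biduality /= /eval_fun /= xE.
Qed.

Lemma transpose_van2 j : ext_van C j.+2 T <-> ext_van C j (Hom M C).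
Proof.
have [q [_ sq]] := transpose_ses; have [_ _ a1] := n1; have [_ _ a0] := n0.
by rewrite (ext_van_shift _ (ses_ker pis) a1) (ext_van_shift _ sq a0).
Qed.

End Presentation.

(** The three criteria above depend on [M] alone. *)
Lemma transpose_van_indep M (i : nat)
    X1 X0 T (d : {linear X1 -> X0}) (p : {linear X0 -> M}) (pi : {linear Hom X1 C -> T})
    (Y1 Y0 U : lmodType R) (d' : {linear Y1 -> Y0}) (p' : {linear Y0 -> M}) (pi' : {linear Hom Y1 C -> U}) :
  bidual_acyclic X1 -> bidual_acyclic X0 -> surj p -> exact_at d p ->
  surj pi -> exact_at (dual C d) pi ->
  bidual_acyclic Y1 -> bidual_acyclic Y0 -> surj p' -> exact_at d' p' ->
  surj pi' -> exact_at (dual C d') pi' ->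
  ext_van C i T <-> ext_van C i U.
Proof.
move=> X1n X0n ps dp pis dpi Y1n Y0n p's dp' pi's dpi'.
case: i => [|[|i]].
- by rewrite (transpose_van0 X1n X0n ps dp pis dpi) (transpose_van0 Y1n Y0n p's dp' pi's dpi').
- by rewrite (transpose_van1 X1n X0n ps dp pis dpi) (transpose_van1 Y1n Y0n p's dp' pi's dpi').
- by rewrite (transpose_van2 X1n X0n ps dp pis dpi) (transpose_van2 Y1n Y0n p's dp' pi's dpi').
Qed.

(** * Cokernels in the dual of an exact complex *)

Section DualComplex.
Variables (X : nat -> lmodType R) (d : forall i, {linear X i.+1 -> X i}).
Hypothesis Xn : forall i, bidual_acyclic (X i).
Hypothesis XS : forall i, exact_at (d i.+1) (d i).

Let dual_exact i := forall g : {linear X i.+1 -> C}, (forall x, g (d i.+1 x) = 0) ->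
  exists b : {linear X i -> C}, forall x, b (d i x) = g x.

Lemma dual_coker_ses m T T' (p : {linear Hom (X m.+1) C -> T})
    (p' : {linear Hom (X m.+2) C -> T'}) :
  dual_exact m -> surj p -> exact_at (dual C (d m)) p ->
  surj p' -> exact_at (dual C (d m.+1)) p' ->
  exists a : {linear T -> Hom (X m.+2) C},
    (forall f, a (p f) = dual C (d m.+1) f) /\ ses a p'.
Proof.
move=> de ps dp ps' dp'.
have [f /dp[g <-]|a aE] := @factor_surj R _ _ _ p (dual C (d m.+1)) ps.
  by apply/Hom_eqP => x; rewrite /= (exact_at0 _ (@XS m)) linear0.
exists a; split=> //; split=> // [t|h].
  have [f <-] := ps t; rewrite aE => f0; apply/dp.
  have [x|b bE] := de f; first exact: (proj2 (Hom_eqP _ _) f0 x).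
  by exists b; apply/Hom_eqP => x; exact: bE.
split=> [/dp'[g <-]|[t <-]]; first by exists (p g); rewrite aE.
by have [f <-] := ps t; rewrite aE (exact_at0 _ dp').
Qed.

(** Each sequence of [dual_coker_ses] has an acyclic middle term and raises the degree by one. For
    [m = 0] both modules are cokernels of the same map, hence isomorphic. *)
Lemma dual_coker_shift m j T0 T (p0 : {linear Hom (X 1) C -> T0})
    (p : {linear Hom (X m.+1) C -> T}) :
  (forall i, (i < m)%N -> dual_exact i) ->
  surj p0 -> exact_at (dual C (d 0)) p0 -> surj p -> exact_at (dual C (d m)) p ->
  ext_van C (j + m) T <-> ext_van C j T0.
Proof.
move=> de p0s dp0; elim: m de T p => [|m IH] de T p ps dp.
  have [f /dp[g <-]|a aE] := @factor_surj R _ _ _ p p0 ps; first exact: (exact_at0 _ dp0).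
  have as_ : surj a by move=> t; have [f <-] := p0s t; exists (p f).
  have ai : inj0 a.
    by move=> t; have [f <-] := ps t; rewrite aE => /dp0 /dp.
  have [x|b bE] := @factor_inj R T0 T T0 a (idfun : {linear T0 -> T0}) ai.
    by have [y yE] := as_ x; exists y.
  have abK : cancel a b by move=> x; apply: (inj0_eq ai); rewrite bE.
  rewrite addn0.
  by rewrite (ext_van_iso C j abK bE).
have [p' [p's dp']] := coker_ex (dual C (d m)).
have [a [_ s]] := dual_coker_ses (de m (ltnSn m)) p's dp' ps dp.
rewrite addnS (ext_van_shift _ s); last by have [] := Xn m.+2.
by apply: (IH _ _ p') => // i im; apply: de; apply: ltnW.
Qed.

(** Shifting reduces to [j = 0]. There a map on the preceding cokernel is evaluation at a cycle [x]
    of [X]; writing [x] as the boundary of [y], evaluation at [y] extends the map. *)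
Lemma dual_coker_van m j T (p : {linear Hom (X m.+1) C -> T}) :
  (forall i, (i < m)%N -> dual_exact i) -> surj p -> exact_at (dual C (d m)) p ->
  (j < m)%N -> ext_van C j T.
Proof.
elim: m j T p => // m IH j T p de ps dp jm.
have [p' [p's dp']] := coker_ex (dual C (d m)).
have [a [aE s]] := dual_coker_ses (de m (ltnSn m)) p's dp' ps dp.
have [_ _ Xa] := Xn m.+2.
case: j jm => [|j] jm.
  rewrite (ext_van0_ses s Xa) => h.
  have [_ X1s _] := Xn m.+1; have [x xE] := X1s (h \o p').
  have [Xi _ _] := Xn m.
  have /XS[y yE] : d m x = 0.
    apply: Xi => f; have := xE (dual C (d m) f).
    by rewrite /= (exact_at0 _ dp') linear0.
  exists (biduality C y) => t; have [f <-] := p's t.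
  by rewrite aE /biduality /= /eval_fun /= yE -xE.
rewrite (ext_van_shift _ s Xa).
by apply: (IH _ _ p') => // i im; apply: de; apply: ltnW.
Qed.

(** By biduality [h \o p] is evaluation at some [x]. It kills the image of [dual C (d m)], which
    forces [d m x = 0] and so [x = 0]. *)
Lemma dual_coker_hom0 m T (p : {linear Hom (X m.+1) C -> T}) :
  inj0 (d m) -> surj p -> exact_at (dual C (d m)) p ->
  forall (h : {linear T -> C}) t, h t = 0.
Proof.
move=> di ps dp h t.
have [_ Xs _] := Xn m.+1; have [x xE] := Xs (h \o p).
have [Xi _ _] := Xn m.
have /di x0 : d m x = 0.
  apply: Xi => f; have := xE (dual C (d m) f).
  by rewrite /= (exact_at0 _ dp) linear0.
by have [f <-] := ps t; have := xE f; rewrite x0 linear0.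
Qed.

End DualComplex.

Lemma projective_zero (Z : lmodType R) : zero_module Z -> projective_module Z.
Proof. by move=> z U V p g _; exists \0 => x; rewrite [x]z !linear0. Qed.

Lemma bidual_acyclic_zero (Z : lmodType R) : zero_module Z -> bidual_acyclic Z.
Proof.
move=> z; have Hz : zero_module (Hom Z C).
  by move=> f; apply/Hom_eqP => x; rewrite [x]z !linear0.
split=> [x _ //|g|]; first by exists 0 => f; rewrite [f]Hz linear0.
exact/acyclic_projective/projective_zero.
Qed.

Lemma bidual_acyclic_retract A B (i : {linear A -> B}) (r : {linear B -> A}) :
  cancel i r -> bidual_acyclic B -> bidual_acyclic A.
Proof.
move=> irK [Bi Bs Ba].
have dK : cancel (dual C r) (dual C i).
  by move=> f; apply/Hom_eqP => x; rewrite /= irK.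
split; last exact: acyclic_retract dK Ba.
- move=> x fx; rewrite -(irK x) [i x]Bi ?linear0 // => f.
  exact: (fx (f \o i)).
- move=> g; have [y yE] := Bs (g \o dual C i).
  by exists (r y) => f; rewrite -(dK f) [LHS]yE /= irK.
Qed.

Lemma bidual_acyclic_prod A B :
  bidual_acyclic A -> bidual_acyclic B -> bidual_acyclic (A * B)%type.
Proof.
move=> [Ai As Aa] [Bi Bs Ba].
have [j1 j1E] := pair_ex (idfun : {linear A -> A}) (\0 : {linear A -> B}).
have [j2 j2E] := pair_ex (\0 : {linear B -> A}) (idfun : {linear B -> B}).
pose r := copair (dual C (fst : {linear (A * B)%type -> A})) (dual C (snd : {linear (A * B)%type -> B})).
have [i iE] := pair_ex (dual C j1) (dual C j2).
have irK : cancel i r.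
  move=> f; rewrite iE copairE; apply/Hom_eqP => -[x y] /=.
  rewrite -linearD j1E j2E; congr (f (_, _)); rewrite /= ?addr0 ?add0r //.
split; last by apply: acyclic_retract irK _; apply: acyclic_prod.
- move=> [x y] fxy; congr (_, _); first by apply: Ai => f; exact: (fxy (f \o fst)).
  by apply: Bi => f; exact: (fxy (f \o snd)).
- move=> g; have [x xE] := As (g \o dual C (fst : {linear (A * B)%type -> A})).
  have [y yE] := Bs (g \o dual C (snd : {linear (A * B)%type -> B})).
  exists (x, y) => f; rewrite -(irK f) iE copairE linearD.
  by rewrite [X in X + _]xE [X in _ + X]yE.
Qed.

Hypothesis Csd : semidualizing C.

(** Evaluation at 1 identifies [Hom R^o C] with [C], its inverse being [s]; biduality of the ring
    thereby becomes the homothety map. *)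
Lemma bidual_acyclic_ring : bidual_acyclic R^o.
Proof.
have [_ [ho hoK hoK'] Ca] := Csd.
have [s sE] : exists s : {linear C -> Hom R^o C}, forall c (r : R^o), s c r = (r : R) *: c.
  have h c : exists f : Hom R^o C, forall r : R^o, f r = (r : R) *: c.
    have [|f fE] := @linear_mk R R^o C (fun r : R => r *: c); last by exists f.
    by move=> a x y; rewrite scalerDl scalerA.
  have [s sE] := choice h.
  have [|s' s'E] := @linear_mk R C (Hom R^o C) s; last by exists s' => c r; rewrite s'E.
  move=> a x y; apply/Hom_eqP => r /=.
  rewrite !sE.
  by rewrite scalerDr !scalerA mulrC.
have sK (f : Hom R^o C) : s (f 1) = f.
  by apply/Hom_eqP => r; rewrite sE -linearZ; congr (f _); rewrite /GRing.scale /= mulr1.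
split.
- move=> x fx; rewrite -(hoK x) -(hoK 0); congr (ho _); apply/Hom_eqP => c.
  by rewrite /homothety /= -sE fx scale0r.
- move=> g; exists (ho (g \o s)) => f.
  have e := proj2 (Hom_eqP _ _) (hoK' (g \o s)) (f 1).
  rewrite -[f in LHS]sK -[LHS]e /homothety /= -linearZ; congr (f _).
  by rewrite /GRing.scale /= mulr1.
- have [ev evE] := @linear_mk R (Hom R^o C) C (fun f => f 1) (fun _ _ _ => erefl _).
  apply: (@acyclic_retract R C _ C ev s); last by apply/acyclicP.
  by move=> f; rewrite evE sK.
Qed.

Lemma bidual_acyclic_row m : bidual_acyclic 'rV[R]_m.
Proof.
elim: m => [|m IH].
  by apply: bidual_acyclic_zero => x; apply/rowP => -[].
have [a x y|f fE] := @linear_mk R 'rV[R]_m.+1 R^o (fun v => v 0 0).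
  by rewrite !mxE.
have [a x y|g gE] := @linear_mk R 'rV[R]_m.+1 'rV[R]_m (fun v : 'rV[R]_m.+1 => \row_(j < m) v 0 (fintype.lift 0 j)).
  by apply/rowP => j; rewrite !mxE.
have [i iE] := pair_ex f g.
have [|r rE] := @linear_mk R (R^o * 'rV[R]_m)%type 'rV[R]_m.+1
    (fun z => \row_(j < m.+1) if unlift 0 j is Some k then z.2 0 k else z.1).
  by move=> a x y; apply/rowP => j; rewrite !mxE; case: unliftP => [k|] _; rewrite ?mxE.
apply: (@bidual_acyclic_retract _ (R^o * 'rV[R]_m)%type i r).
  move=> v; rewrite iE rE; apply/rowP => j; rewrite !mxE /=.
  by case: unliftP => [k|] ->; rewrite ?gE ?mxE ?fE.
by apply: bidual_acyclic_prod => //; exact: bidual_acyclic_ring.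
Qed.

Lemma finite_row M : finite_module M <->
  exists m, exists p : {linear 'rV[R]_m -> M}, surj p.
Proof.
split=> [[s sE]|[m [p ps]]].
  have [p pE] := row_comb_ex (fun i : 'I_(size s) => s`_i).
  exists (size s), p => x; have [c ->] := sE x; exists (\row_i c i); rewrite pE.
  by apply: eq_bigr => i _; rewrite mxE.
exists [seq p (delta_mx 0 i) | i <- enum 'I_m] => x.
have [v <-] := ps x.
(* The coefficients are indexed by all natural numbers, hence the value 0 out of range. *)
exists (fun i => if insub i is Some k then v 0 k else 0).
rewrite [v in LHS]row_sum_delta linear_sum.
have sz : size [seq p (delta_mx 0 i) | i <- enum 'I_m] = m by rewrite size_map size_enum_ord.
rewrite -(big_mkord predT (fun i => (if insub i is Some k then v 0 k else 0) *:
   [seq p (delta_mx 0 i) | i <- enum 'I_m]`_i)) sz big_mkord.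
apply: eq_bigr => i _; rewrite linearZ valK.
by rewrite (nth_map i) ?size_enum_ord // nth_ord_enum.
Qed.

Lemma bidual_acyclic_projective P : finite_module P -> projective_module P ->
  bidual_acyclic P.
Proof.
move=> /finite_row[m [p ps]] Pp; have [s sE] := projective_split Pp ps.
exact: bidual_acyclic_retract sE (@bidual_acyclic_row m).
Qed.

End Transpose.

(** * Presentations over Noetherian rings *)

Section NoetherianPresentation.
Set Implicit Arguments.
Unset Strict Implicit.
Unset Printing Implicit Defensive.
Import GRing.Theory.
Local Open Scope ring_scope.

Variable R : comNzRingType.
Implicit Types M : lmodType R.

Lemma row_projective m : projective_module 'rV[R]_m.
Proof.
move=> U V p g ps; have [u uE] := choice (fun i => ps (g (delta_mx 0 i))).
have [h hE] := row_comb_ex u; exists h => v.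
rewrite [v in RHS]row_sum_delta hE !linear_sum; apply: eq_bigr => i _.
by rewrite !linearZ /= uE.
Qed.

(** By induction on [m]: [f1] hits generators of the ideal of first coordinates of [S], and what is
    left has first coordinate 0, so that it comes from a shorter row through [sh]. *)
Lemma noetherian_row m (S : 'rV[R]_m -> Prop) : noetherian R -> S 0 ->
  (forall x y, S x -> S y -> S (x + y)) -> (forall a x, S x -> S (a *: x)) ->
  exists k, exists f : {linear 'rV[R]_k -> 'rV[R]_m}, forall x, S x <-> exists u, f u = x.
Proof.
move=> Rn; elim: m S => [|m IH] S S0 SD SZ.
  exists 0%N, \0 => x; rewrite [x](_ : _ = 0); last by apply/rowP => -[].
  by split=> // _; exists 0.
have SN x y : S x -> S y -> S (x - y).
  by move=> Sx Sy; apply: SD => //; rewrite -scaleN1r; apply: SZ.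
have [|s sE] := Rn (fun a => exists2 v, S v & v 0 0 = a).
  split; first by exists 0; rewrite ?mxE.
    by move=> x y [v Sv <-] [w Sw <-]; exists (v + w); [exact: SD|rewrite mxE].
  by move=> a x [v Sv <-]; exists (a *: v); [exact: SZ|rewrite mxE].
have /choice[w wE] : forall i : 'I_(size s), exists v, S v /\ v 0 0 = s`_i.
  move=> i; have [|v Sv vE] := (sE s`_i).2; last by exists v.
  exists (fun j : nat => (j == i :> nat)%:R); rewrite (bigD1 i) //= eqxx mul1r big1 ?addr0 // => j ji.
  by rewrite (_ : (j == i :> nat) = false) ?mul0r //; apply/negbTE.
have [f1 f1E] := row_comb_ex w.
have f1S v : S (f1 v).
  by rewrite f1E; apply: (big_ind S) => // i _; apply: SZ; case: (wE i).
have [a x y|sh shE] := @linear_mk R 'rV[R]_m 'rV[R]_m.+1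
    (fun v : 'rV[R]_m => \row_(j < m.+1) if unlift 0 j is Some k then v 0 k else 0).
  by apply/rowP => j; rewrite !mxE; case: unliftP => [k|] _; rewrite ?mxE ?mulr0 ?addr0.
have [|x y|a x|k [f2 f2E]] := IH (fun y => S (sh y)).
- by rewrite linear0.
- by rewrite linearD; apply: SD.
- by rewrite linearZ; apply: SZ.
exists (size s + k)%N.
exists ((f1 \o (@lsubmx R 1 (size s) k)) \+ (sh \o (f2 \o (@rsubmx R 1 (size s) k)))) => x.
split=> [Sx|[u <-]]; last by apply: SD => //=; apply/f2E; eexists.
have [|c cE] := (sE (x 0 0)).1; first by exists x.
pose u1 : 'rV[R]_(size s) := \row_i c i.
have e : (f1 u1) 0 0 = x 0 0.
  rewrite f1E summxE cE; apply: eq_bigr => i _.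
  by rewrite !mxE; case: (wE i) => _ ->.
have yE : sh (\row_(j < m) (x - f1 u1) 0 (fintype.lift 0 j)) = x - f1 u1.
  rewrite shE; apply/rowP => j; rewrite mxE.
  by case: unliftP => [i ->|->]; rewrite !mxE // e subrr.
have /f2E[u2 u2E] : S (sh (\row_(j < m) (x - f1 u1) 0 (fintype.lift 0 j))).
  by rewrite yE; apply: SN.
exists (row_mx u1 u2); rewrite /= row_mxKl row_mxKr u2E yE.
by rewrite addrC subrK.
Qed.

Lemma presentation_ex M : noetherian R -> finite_module M ->
  exists (P1 P0 : lmodType R) (f : {linear P1 -> P0}) (p : {linear P0 -> M}),
    presentation f p.
Proof.
move=> Rn /finite_row[m [p ps]].
have [|x y px py|a x px|k [f fE]] := noetherian_row (S := fun x => p x = 0) Rn.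
- by rewrite linear0.
- by rewrite linearD px py addr0.
- by rewrite linearZ_LR px scaler0.
have fin n : finite_module 'rV[R]_n.
  by apply/finite_row; exists n, idfun => x; exists x.
by exists 'rV[R]_k, 'rV[R]_m, f, p; split=> //; split=> //; exact: row_projective.
Qed.

End NoetherianPresentation.

(** * Grade with respect to C and to R *)

Section Grade.
Set Implicit Arguments.
Unset Strict Implicit.
Unset Printing Implicit Defensive.
Import GRing.Theory.
Local Open Scope ring_scope.

Variable R : comNzRingType.
Implicit Types A B C L M N U V W Y : lmodType R.

Lemma det_eq_col n (A : 'M[R]_n) j1 j2 : j1 != j2 ->
  (forall i, A i j1 = A i j2) -> \det A = 0.
Proof.
move=> j12 e; rewrite -det_tr; apply: (determinant_alternate j12) => i.
by rewrite !mxE.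
Qed.

(* McCoy's argument: a minor of maximal size of the relation matrix of [C] that
   does not kill [l], bordered by one more column, gives by its cofactors a
   solution of the linear system defining Hom(C, L). *)
Lemma faithful_hom_neq0 C L (l : L) : finite_module C ->
  (forall a : R, (forall c : C, a *: c = 0) -> a = 0) -> l <> 0 ->
  exists (psi : {linear C -> L}) c, psi c <> 0.
Proof.
move=> /finite_row[r [p ps]] Cf l0.
pose minor t (A : 'M[R]_(t, r)) (f : 'I_t -> 'I_r) := \det (\matrix_(i, j) A i (f j)).
pose P t := exists (A : 'M[R]_(t, r)) (f : 'I_t -> 'I_r),
  (forall i, p (row i A) = 0) /\ minor t A f *: l <> 0.
have inj t (A : 'M[R]_(t, r)) f : minor t A f *: l <> 0 -> injective f.
  move=> m0 j1 j2 e; apply/eqP/negP => /negP j12; apply: m0.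
  by rewrite /minor (det_eq_col j12) ?scale0r // => i; rewrite !mxE e.
have P0 : exists t, `[< P t >].
  exists 0%N; apply/asboolP; exists 0, (widen_ord (leq0n r)).
  by split=> [[]//|]; rewrite /minor det_mx00 scale1r.
have Pr t : `[< P t >] -> (t <= r)%N.
  by move=> /asboolP[A [f [_ /inj fi]]]; have := leq_card f fi; rewrite !card_ord.
case: (ex_maxnP P0 Pr) => t /asboolP[A [f [Ap m0]]] tmax.
have fi := inj _ _ _ m0; pose D := minor t A f.
(* Otherwise [f] uses all columns, and by Cramer's rule [D] times each basis vector is a combination
   of rows of [A]. Then [D] kills [C], so [D = 0] by faithfulness. *)
have [j0 j0f] : exists j0, forall k, f k != j0.
  apply: contrapT => nex; apply: m0; rewrite -/D.
  suff -> : D = 0 by rewrite scale0r.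
  apply: Cf => c; have [v <-] := ps c.
  rewrite [v]row_sum_delta linear_sum scaler_sumr big1 // => j _.
  rewrite linearZ_LR scalerA mulrC -scalerA.
  suff -> : D *: p (delta_mx 0 j) = 0 by rewrite scaler0.
  rewrite -linearZ_LR.
  have [k kE] : exists k, f k = j.
    apply: contrapT => nk; apply: nex; exists j => k; apply/eqP => kj.
    by apply: nk; exists k.
  set B := (\matrix_(i, j) A i (f j) : 'M[R]_t).
  have -> : D *: delta_mx 0 j = row k (\adj B *m A).
    apply/rowP => j'; rewrite !mxE eqxx /=.
    have [i iE] : exists i, f i = j'.
      apply: contrapT => nk; apply: nex; exists j' => i; apply/eqP => ij.
      by apply: nk; exists i.
    have /matrixP/(_ k i) := mul_adj_mx B; rewrite [LHS]mxE [RHS]mxE => e.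
    transitivity (\det B *+ (k == i)).
      by rewrite -iE -kE (inj_eq fi) eq_sym mulr_natr.
    by rewrite -e; apply: eq_bigr => i' _; rewrite !mxE iE.
  rewrite row_mul mulmx_sum_row linear_sum big1 // => i _.
  by rewrite linearZ_LR Ap scaler0.
(* The bordered minor has the new column [j0] in front and the new row [b] on top; the cofactors [x]
   along that row do not depend on [b]. *)
pose g (k : 'I_t.+1) := if unlift 0 k is Some k' then f k' else j0.
pose bord (b : 'rV[R]_r) : 'M[R]_(t.+1, r) :=
  \matrix_(i, j) if unlift 0 i is Some i' then A i' j else b 0 j.
pose Bm b : 'M[R]_t.+1 := \matrix_(i, j) bord b i (g j).
pose x j := cofactor (Bm 0) 0 j.
have detB b : \det (Bm b) = \sum_j b 0 (g j) * x j.
  rewrite (expand_det_row _ 0); apply: eq_bigr => j _; congr (_ * _).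
    by rewrite !mxE unlift_none.
  rewrite /x /cofactor; congr (_ * \det _); apply/matrixP => i k.
  by rewrite !mxE liftK.
(* For a relation [b] the matrix [bord b] consists of relations, so maximality of [t] applies. Hence
   [Psi] below factors through [C]. *)
have kill b : p b = 0 -> \det (Bm b) *: l = 0.
  move=> pb; apply: contrapT => nz.
  suff /asboolP/tmax : P t.+1 by rewrite ltnn.
  exists (bord b), g; split=> // i; case: (unliftP 0 i) => [i'|] ->.
    by rewrite -[RHS](Ap i'); congr (p _); apply/rowP => j; rewrite !mxE liftK.
  by rewrite -[RHS]pb; congr (p _); apply/rowP => j; rewrite !mxE unlift_none.
have [a u v|Psi PsiE] := @linear_mk R 'rV[R]_r L (fun b : 'rV[R]_r => \det (Bm b) *: l).
  rewrite !detB scalerA -scalerDl; congr (_ *: _).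
  rewrite mulr_sumr -big_split; apply: eq_bigr => j _.
  by rewrite /= !mxE mulrDl -mulrA.
have [b pb|psi psiE] := @factor_surj R _ _ _ p Psi ps; first by rewrite PsiE kill.
(* Here only the first term of the expansion survives, and its cofactor is the original minor: the
   value is [D *: l]. *)
exists psi, (p (delta_mx 0 j0)); rewrite psiE PsiE detB.
rewrite (bigD1 0) //= big1 => [|j]; last first.
  case: (unliftP 0 j) => [k|] -> // _.
  by rewrite /g liftK mxE eqxx /= (negbTE (j0f k)) mul0r.
rewrite /g unlift_none mxE !eqxx mul1r addr0 /x /cofactor addn0 expr0 mul1r.
suff -> : row' 0 (col' 0 (Bm 0)) = \matrix_(i, j) A i (f j) by [].
by apply/matrixP => i k; rewrite !mxE liftK /g liftK.
Qed.

Lemma swap_ex A B C (h : {linear A -> Hom B C}) :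
  exists h' : {linear B -> Hom A C}, forall b a, (h' b : {linear A -> C}) a = (h a : {linear B -> C}) b.
Proof.
have /choice[s sE] b : exists f : Hom A C, forall a, f a = (h a : {linear B -> C}) b.
  have [a x y|f fE] := @linear_mk R A C (fun a => (h a : {linear B -> C}) b); last by exists f.
  by rewrite linearP.
have [a x y|s' s'E] := @linear_mk R B (Hom A C) s.
  by apply/Hom_eqP => z /=; rewrite !sE linearP.
by exists s' => b a; rewrite s'E.
Qed.

(** * Vanishing of cohomology along a coresolution of the coefficients *)

Section DoubleComplex.
Variables (Q : nat -> lmodType R) (d : forall j, {linear Q j.+1 -> Q j}).
Hypothesis Q0 : zero_module (Q 0).
Hypothesis Qp : forall j, projective_module (Q j).
Hypothesis dd : forall j x, d j (d j.+1 x) = 0.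

(* Vanishing of the [j]-th cohomology of Hom(Q, Y), the complex [Q] being placed
   so that its term of degree [j] is [Q j.+1]. *)
Definition coh_van (j : nat) Y := forall c : {linear Q j.+1 -> Y},
  (forall x, c (d j.+1 x) = 0) -> exists b : {linear Q j -> Y}, forall x, b (d j x) = c x.

Variables (C Y : lmodType R) (G : nat -> lmodType R).
Variables (e : {linear Y -> G 0}) (s : forall i, {linear G i -> G i.+1}).
Hypotheses (ei : inj0 e) (es : exact_at e (s 0)).
Hypothesis ss : forall i, exact_at (s i) (s i.+1).

(** If [b0] bounds [c], then [s i \o b0] is a cocycle one degree lower, bounded inductively by some
    [b'] that [s i.+1] kills. Lifting [b'] along [s i] and subtracting its coboundary corrects
    [b0]. *)
Lemma coh_van_cocycle j i : (forall j' i', (j' <= j)%N -> coh_van j' (G i')) ->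
  forall c : {linear Q j.+1 -> G i}, (forall x, c (d j.+1 x) = 0) -> (forall x, s i (c x) = 0) ->
  exists b : {linear Q j -> G i}, (forall x, b (d j x) = c x) /\ (forall x, s i (b x) = 0).
Proof.
elim: j i => [|j IH] i van c cd sc; have [b0 b0E] := van _ i (leqnn _) c cd.
  by exists b0; split=> // x; rewrite [x]Q0 !linear0.
have [|x|x|b' [b'E sb']] := IH i.+1 _ (s i \o b0 : {linear Q j.+1 -> G i.+1}).
- by move=> j' i' jj; apply: van; apply: leqW.
- by rewrite /= b0E sc.
- exact: (exact_at0 _ (@ss i)).
have [x|b2 b2E] := projective_lift (d := s i) (g := b') (@Qp j).
  by apply/ss.
exists (b0 \- (b2 \o d j)); split=> x /=.
  by rewrite dd linear0 subr0.
by rewrite linearB b2E b'E subrr.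
Qed.

(** The same correction, applied to a cochain [c] whose coboundary is killed by [s i]. *)
Lemma coh_van_correct j i (c : {linear Q j -> G i}) :
  (forall j' i', (j' < j)%N -> coh_van j' (G i')) -> (forall x, s i (c (d j x)) = 0) ->
  exists c' : {linear Q j -> G i}, (forall x, c' (d j x) = c (d j x)) /\ (forall x, s i (c' x) = 0).
Proof.
case: j c => [|j] c van sc.
  by exists c; split=> // x; rewrite [x]Q0 !linear0.
have [x|x|b [bE sb]] := coh_van_cocycle (i := i.+1) (j := j) van (c := s i \o c).
- exact: sc.
- exact: (exact_at0 _ (@ss i)).
have [x|b' b'E] := projective_lift (d := s i) (g := b) (@Qp j).
  by apply/ss.
exists (c \- (b' \o d j)); split=> x /=.
  by rewrite dd linear0 subr0.
by rewrite linearB b'E bE subrr.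
Qed.

Lemma coh_van_coresolution j : (forall j' i', (j' <= j)%N -> coh_van j' (G i')) -> coh_van j Y.
Proof.
move=> van c cd.
have [x|x|b [bE sb]] := coh_van_cocycle van (c := e \o c).
- by rewrite /= cd linear0.
- exact: (exact_at0 _ es).
have [x|b' b'E] := factor_inj (i := e) (g := b) ei; first by apply/es.
by exists b' => x; apply: (inj0_eq ei); rewrite b'E bE.
Qed.

(** With the arguments exchanged, a cocycle is a map from [F] to the cocycles with values in [C].
    These are coboundaries, and projectivity of [F] lifts the map to cochains. *)
Lemma coh_van_projective j F : projective_module F -> coh_van j C -> coh_van j (Hom F C).
Proof.
move=> Fp van c cd; have [c' c'E] := swap_ex c.
have [f|h hE] := projective_lift (d := dual C (d j)) (g := c') Fp.
  have [x|b bE] := van (c' f); first by rewrite c'E cd.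
  by exists b; apply/Hom_eqP.
have [h' h'E] := swap_ex h; exists h' => x; apply/Hom_eqP => f.
by rewrite h'E -c'E; exact: (proj2 (Hom_eqP _ _) (hE f) x).
Qed.

End DoubleComplex.

Section DoubleComplexConverse.
Variables (Q : nat -> lmodType R) (d : forall j, {linear Q j.+1 -> Q j}).
Hypothesis Q0 : zero_module (Q 0).
Hypothesis Qp : forall j, projective_module (Q j).
Hypothesis dd : forall j x, d j (d j.+1 x) = 0.
Variables (C Y : lmodType R) (F : nat -> lmodType R).
Variables (r : forall i, {linear F i.+1 -> F i}) (a : {linear F 0 -> C}).
Hypotheses (as_ : surj a) (ra : exact_at (r 0) a).
Hypothesis Fp : forall i, projective_module (F i).
Variable e : {linear Y -> Hom (F 0) C}.
Let s i := dual C (r i).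
Hypotheses (ei : inj0 e) (es : exact_at e (s 0)).
Hypothesis ss : forall i, exact_at (s i) (s i.+1).
Hypothesis Chom : forall L (l : L), l <> 0 -> exists (psi : {linear C -> L}) c, psi c <> 0.

(* A nonzero class in degree [j] spans the image of some nonzero map from [C] to
   the cohomology, which lifts to a cocycle of the double complex
   Hom(Q, Hom(F, C)), hence comes from the cohomology of Hom(Q, Y). *)
Lemma coh_van_converse j : (forall j' i', (j' < j)%N -> coh_van d j' (Hom (F i') C)) ->
  coh_van d j Y -> coh_van d j C.
Proof.
move=> van vanY; have [p [ps pE]] := homology_proj (dual C (d j)) (dual C (d j.+1)).
suff L0 : forall l : homology (dual C (d j)) (dual C (d j.+1)), l = 0.
  move=> c cd; have [|z zE] := @kval_ex R _ _ (dual C (d j.+1)) c.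
    by apply/Hom_eqP => x; exact: cd.
  have /pE[b bE] := L0 (p z); exists b => x.
  by rewrite zE in bE; exact: (proj2 (Hom_eqP _ _) bE x).
move=> l; apply: contrapT => /Chom[psi [c]]; apply.
(* [P0] lifts [psi \o a] to cocycles; its composite with [r 0] consists of coboundaries, bounded by
   [P1]. With arguments exchanged these become [c0] and [c1]. *)
have [P0 P0E] := Fp (psi \o a) ps.
have [u|P1 P1E] := projective_lift (d := dual C (d j)) (g := kval (dual C (d j.+1)) \o (P0 \o r 0)) (@Fp 1).
  by apply/pE; rewrite P0E /= (exact_at0 _ ra) linear0.
have [c0 c0E] := swap_ex (kval (dual C (d j.+1)) \o P0).
have [c1 c1E] := swap_ex P1.
have sc0 x : s 0 (c0 x) = c1 (d j x).
  apply/Hom_eqP => u; rewrite c1E [LHS]/= c0E.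
  by rewrite -[LHS]/((kval (dual C (d j.+1)) \o (P0 \o r 0)) u x) -P1E.
have c0d x : c0 (d j.+1 x) = 0.
  apply/Hom_eqP => u; rewrite c0E.
  exact: (proj2 (Hom_eqP _ _) (kvalP (P0 u)) x).
(* Made into a cochain killed by [s 1], [c1] lifts to [h] along [s 0]. Then [c0] minus the
   coboundary of [h] is a cocycle [t] with values in [Y], hence a coboundary, and so [psi c = 0]. *)
have [x|c1' [c1'd sc1']] := coh_van_correct Q0 Qp dd (s := s) ss (i := 1) (c := c1) van.
  by rewrite -sc0 (exact_at0 _ (@ss 0)).
have [x|h hE] := projective_lift (d := s 0) (g := c1') (@Qp j).
  by apply/ss.
have [x|t tE] := @factor_inj R _ _ _ e (c0 \- (h \o d j)) ei.
  by apply/es; rewrite linearB sc0 /= hE c1'd subrr.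
have [x|b bE] := vanY t.
  by apply: ei; rewrite tE /= c0d dd linear0 subrr.
have c0b x : c0 x = (e \o b \+ h) (d j x).
  by rewrite /= bE tE /= subrK.
have [b' b'E] := swap_ex (e \o b \+ h).
have [f <-] := as_ c.
rewrite -[LHS]P0E; apply/pE; exists (b' f); apply/Hom_eqP => x.
by rewrite -c0E c0b -b'E.
Qed.

End DoubleComplexConverse.
End Grade.

(** * Reduced perfect modules *)

Section ReducedPerfect.
Set Implicit Arguments.
Unset Strict Implicit.
Unset Printing Implicit Defensive.
Import GRing.Theory.
Local Open Scope ring_scope.

Variable R : comNzRingType.
Implicit Types C M N Y T : lmodType R.

(* The additional zero term lets the cohomology in degree 0 be treated like that
   in positive degrees. *)
Definition shifted_res N (j : nat) : lmodType R :=
  if j is i.+1 then res_mod N i else 'rV[R]_0.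

Definition shifted_res_d N (j : nat) : {linear shifted_res N j.+1 -> shifted_res N j} :=
  match j return {linear shifted_res N j.+1 -> shifted_res N j} with
  | i.+1 => res_d N i
  | 0 => (\0 : {linear res_mod N 0 -> 'rV[R]_0})
  end.

Lemma zero_Ext_coh j N Y : zero_module (Ext j N Y) <-> coh_van (shifted_res_d N) j Y.
Proof.
case: j => [|j]; last exact: zero_ExtS_cocycle.
rewrite zero_Ext0; split=> [z c cd|van h x].
  have [x /res_exact0[y <-]|h hE] := @factor_surj R _ _ _ _ c (@res_aug_surj R N); first exact: cd.
  by exists \0 => x; rewrite -hE z.
have [y <-] := @res_aug_surj R N x.
have [z|b bE] := van (h \o res_aug N).
  by rewrite /= (exact_at0 _ (@res_exact0 R N)) linear0.
by have := bE y; rewrite /= linear0 => <-.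
Qed.

Lemma zero_Ext_semidualizing C N m : semidualizing C ->
  (forall j, (j < m)%N -> zero_module (Ext j N R^o)) <->
  (forall j, (j < m)%N -> zero_module (Ext j N C)).
Proof.
move=> [Cf [ho hoK hoK'] Ca].
have ho_inj a : (forall c : C, a *: c = 0) -> a = 0.
  move=> a0; rewrite -(hoK a) -(hoK 0); congr (ho _); apply/Hom_eqP => c.
  by rewrite /homothety /= a0 scale0r.
(* [e] and [s] form the coresolution of [R]: its exactness comes from the homothety map at the start
   and from the vanishing of Ext(C, C) afterwards. *)
have [a x y|e eE] := @linear_mk R R^o (Hom (res_mod C 0) C) (fun a => dual C (res_aug C) (homothety C a)).
  rewrite -linearP; congr (dual C _ _); apply/Hom_eqP => c.
  by rewrite /homothety /= scalerDl scalerA.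
pose s i := dual C (res_d C i).
have ei : inj0 e.
  move=> a; rewrite eE => a0; apply: ho_inj => c; have [x <-] := @res_aug_surj R C c.
  exact: (proj2 (Hom_eqP _ _) a0 x).
have es : exact_at e (s 0).
  move=> f; split=> [f0|[a <-]]; last first.
    by rewrite eE; apply/Hom_eqP => x; rewrite /= (exact_at0 _ (@res_exact0 R C)) linear0.
  have [x /res_exact0[y <-]|h hE] := @factor_surj R _ _ _ _ f (@res_aug_surj R C).
    exact: (proj2 (Hom_eqP _ _) f0 y).
  exists (ho h); rewrite eE; apply/Hom_eqP => x; rewrite -hE.
  exact: (proj2 (Hom_eqP _ _) (hoK' h) (res_aug C x)).
have ss i : exact_at (s i) (s i.+1).
  move=> f; split=> [f0|[g <-]].
    have [x|b bE] := (zero_ExtS_cocycle i C C).1 (Ca i.+1 isT) f.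
      exact: (proj2 (Hom_eqP _ _) f0 x).
    by exists b; apply/Hom_eqP.
  by apply/Hom_eqP => x; rewrite /= (exact_at0 _ (@res_exactS R C i)) linear0.
have Q0 : zero_module (shifted_res N 0) by move=> x; apply/rowP => -[].
have Qp j : projective_module (shifted_res N j).
  by case: j => [|j]; [exact: projective_zero|exact: res_mod_projective].
have dd j x : shifted_res_d N j (shifted_res_d N j.+1 x) = 0.
  by case: j x => [//|j] x; exact: (exact_at0 _ (@res_exactS R N j)).
have vanH j i : zero_module (Ext j N C) -> coh_van (shifted_res_d N) j (Hom (res_mod C i) C).
  by move=> /zero_Ext_coh; apply: coh_van_projective; apply: res_mod_projective.
(* From [R] to [C] strong induction is used, as [coh_van_converse] asks for vanishing for [C] in all
   lower degrees. *)
split=> van j jm.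
  elim/ltn_ind: j jm => j IH jm; apply/zero_Ext_coh.
  apply: (coh_van_converse Q0 Qp dd (@res_aug_surj R C) (@res_exact0 R C)
    (@res_mod_projective R C) ei es ss) => [L l|j' i' j'j|].
  - exact: faithful_hom_neq0.
  - by apply: vanH; apply: IH => //; apply: ltn_trans jm.
  - by apply/zero_Ext_coh; apply: van.
apply/zero_Ext_coh; apply: (coh_van_coresolution Q0 Qp dd ei es ss) => j' i' j'j.
by apply: vanH; apply: van; apply: leq_ltn_trans jm.
Qed.

Lemma grade_geP N m : enat_le m (grade N) <->
  (forall j, (j < m)%N -> zero_module (Ext j N R^o)).
Proof.
rewrite /grade; case E: (einf _) => [g|].
  have [/= Pg gmin] := (einf_SomeP _ _).1 E; split=> [mg j jm|z].
    apply: contrapT => nz; have := gmin j nz.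
    by rewrite leqNgt (leq_trans jm mg).
  by rewrite leqNgt; apply/negP => gm; apply: Pg; apply: z.
split=> // _ j _; apply: contrapT => nz.
by have /(_ j) := (einf_NoneP _).1 E; apply.
Qed.

(** By [transpose_van_indep] the transpose may be formed from the start of a totally C-reflexive
    resolution instead of finite projective modules. *)
Lemma torsionless_transpose C M (X1 X0 : lmodType R) T k (d : {linear X1 -> X0}) (p : {linear X0 -> M})
    (pi : {linear Hom X1 C -> T}) :
  noetherian R -> semidualizing C -> finite_module M ->
  bidual_acyclic C X1 -> bidual_acyclic C X0 -> surj p -> exact_at d p ->
  surj pi -> exact_at (dual C d) pi ->
  torsionless C k M <-> forall i, (i < k)%N -> ext_van C i T.
Proof.
move=> Rn Cs Mf n1 n0 ps dp pis dpi.
have tr (P1 P0 : lmodType R) (f : {linear P1 -> P0}) (q : {linear P0 -> M}) i : presentation f q ->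
    zero_module (Ext i.+1 (Tr C f) C) <-> ext_van C i T.
  move=> [[P1f P1p] [P0f P0p] qs fq]; rewrite zero_ExtS.
  have [r [rs fr]] := coker_ex (dual C f).
  have P1n := bidual_acyclic_projective Cs P1f P1p.
  have P0n := bidual_acyclic_projective Cs P0f P0p.
  exact: (transpose_van_indep i P1n P0n qs fq rs fr n1 n0 ps dp pis dpi).
split=> [[_ [->//|[_ [P1 [P0 [f [q [pr z]]]]]]]] i ik|van].
  by apply/(tr _ _ _ _ _ pr); apply: z.
split=> //; case: k van => [|k] van; [by left|right; split=> //].
have [P1 [P0 [f [q pr]]]] := presentation_ex Rn Mf.
exists P1, P0, f, q; split=> // -[//|i] ik.
by apply/(tr _ _ _ _ _ pr); apply: van.
Qed.

Lemma torsionless_grade C M n k : noetherian R -> semidualizing C ->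
  reduced_GC_perfect C M -> GCdim C M = Some n ->
  torsionless C k M <-> enat_le (n + k) (grade (Ext n M C)).
Proof.
move=> Rn Cs [Mf _ rg] gd; have [[X [d [e [es ex0 exS Xr Xz]]]] _] := (einf_SomeP _ _).1 gd.
rewrite gd in rg; have [/= [n0 _] nmin] := (einf_SomeP _ _).1 rg.
(* [rgrade] only sees positive degrees, so [n] is some [m.+1]. *)
case: n => [|m] // in gd rg n0 nmin Xr Xz *.
have Xn i : bidual_acyclic C (X i).
  have [im|im] := leqP i m.+1; first exact/totally_reflexive_bidual/Xr.
  exact/bidual_acyclic_zero/Xz.
have Xa i : acyclic C (X i).
  have [im|im] := leqP i m.+1; last exact/acyclic_projective/projective_zero/Xz.
  by have [_ _ a _] := Xr i im; apply/acyclicP.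
have dex i : (i < m)%N -> forall g : {linear X i.+1 -> C}, (forall x, g (d i.+1 x) = 0) ->
    exists b : {linear X i -> C}, forall x, b (d i x) = g x.
  move=> im; apply/(ext_van_resolution i es ex0 exS Xa)/zero_ExtS.
  apply: contrapT => nz; have : (m.+1 <= i.+1)%N by apply: nmin.
  by rewrite ltnS leqNgt im.
have [t [ts dt]] := Ext_coker es ex0 exS Xa (Xz _ (ltnSn m.+1)).
have [p0 [p0s dp0]] := coker_ex (dual C (d 0)).
rewrite (torsionless_transpose k Rn Cs Mf (Xn 1) (Xn 0) es ex0 p0s dp0).
rewrite grade_geP (zero_Ext_semidualizing _ _ Cs).
have sh j := dual_coker_shift Xn exS j dex p0s dp0 ts dt.
(* Degree 0 vanishes as [d m] is injective, and degrees [j.+1] with [j < m] vanish by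
   [dual_coker_van]. The remaining [k] degrees match, by [sh], the first [k] positive ones of the
   transpose. *)
split=> van.
  case=> [_|j jk].
    apply/zero_Ext0; apply: (dual_coker_hom0 Xn _ ts dt) => x /exS[y <-].
    by rewrite [y]Xz // linear0.
  apply/zero_ExtS; have [jm|mj] := ltnP j m; first exact: (dual_coker_van Xn exS dex ts dt jm).
  rewrite -(subnK mj); apply/sh/van.
  by rewrite ltn_subLR // -ltnS -addSn.
move=> i ik; apply/sh/zero_ExtS/van.
by rewrite addSn ltnS addnC ltn_add2l.
Qed.

End ReducedPerfect.

Theorem proposition6p3 (R : comNzRingType) (C M : lmodType R) (n k : nat) :
  noetherian R -> semiperfect R -> semidualizing C ->
  reduced_GC_perfect C M -> GCdim C M = Some n ->
  torsionless C k M <-> enat_le (n + k) (grade (Ext n M C)).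
Proof. by move=> Rn _; apply: torsionless_grade. Qed.
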